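(* Let $F_n$ be the free group of finite rank $n$, and let $H\leqslant F_n$ be a finitely generated subgroup, where $H\neq\{1\}$ and $F_n\neq\{1\}$. Then $H$ admits a nontrivial $\oplus$-complement in $F_n$ if and only if $H$ has infinite index in $F_n$. Hence there is an algorithm which, given a finite set of generators (as words in the basis of $F_n$) of such a subgroup $H$, decides whether $H$ admits a nontrivial $\oplus$-complement.
   Context: For subgroups $H,K$ of a group $G$, $H\vee K=\langle H\cup K\rangle$ denotes their join. $K$ is a $\oplus$-complement of $H$ (in $G$) if $H\vee K=G$ and $H\cap K=\{1\}$; this is written $H\oplus K=G$. A nontrivial $\oplus$-complement is a $\oplus$-complement $K\neq\{1\}$. *)

(* Defs.v *)
From HB Require Import structures.
From mathcomp Require Import all_boot all_classical.

Set Implicit Arguments.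
Unset Strict Implicit.
Unset Printing Implicit Defensive.

Local Open Scope classical_set_scope.
Local Open Scope group_scope.

(* [(i, false)] stands for the letter x_i and [(i, true)] for x_i^{-1}. *)
Definition letter (n : nat) : Type := ('I_n * bool)%type.
Definition word (n : nat) : Type := seq (letter n).

Section FreeGroup.
Variable n : nat.
Implicit Types (a b : letter n) (u v w : word n).

Definition linv a : letter n := (a.1, ~~ a.2).

Definition reduced w : bool := sorted (fun a b => b != linv a) w.

Definition cons_reduced a w : word n :=
  if w is b :: w' then if b == linv a then w' else a :: w else [:: a].

Definition reduce_cat u v : word n := foldr cons_reduced v u.

Lemma linvK : involutive linv.
Proof. by case=> i e; rewrite /linv /= negbK. Qed.

Lemma cons_reducedP a w : reduced w -> reduced (cons_reduced a w).
Proof.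
case: w => [//|b w] /= rw; case: ifP => [_|nab] /=; last by rewrite nab.
exact: path_sorted rw.
Qed.

Lemma cons_reducedE a w : reduced (a :: w) -> cons_reduced a w = a :: w.
Proof. by case: w => [//|b w] /= /andP[/negbTE ->]. Qed.

Lemma cons_reducedK a w :
  reduced w -> cons_reduced a (cons_reduced (linv a) w) = w.
Proof.
case: w => [|b w] rw /=; first by rewrite eqxx.
rewrite linvK; case: eqP => [ba|nba] /=; last by rewrite eqxx.
by subst b; exact: cons_reducedE.
Qed.

Lemma reduce_catP u v : reduced v -> reduced (reduce_cat u v).
Proof. by move=> rv; elim: u => //= a u; exact: cons_reducedP. Qed.

Lemma reduce_cats0 u : reduced u -> reduce_cat u [::] = u.
Proof.
elim: u => //= a u IHu ru; rewrite IHu; last exact: path_sorted ru.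
exact: cons_reducedE.
Qed.

Lemma reduce_cat_cons a u w : reduced w ->
  reduce_cat (cons_reduced a u) w = cons_reduced a (reduce_cat u w).
Proof.
move=> rw; case: u => [//|b u] /=; case: eqP => [->|//].
by rewrite cons_reducedK //; exact: reduce_catP.
Qed.

Lemma reduce_catA u v w : reduced w ->
  reduce_cat u (reduce_cat v w) = reduce_cat (reduce_cat u v) w.
Proof. by move=> rw; elim: u => //= a u ->; rewrite reduce_cat_cons. Qed.

Definition winv w : word n := rev (map linv w).

Lemma winvP w : reduced w -> reduced (winv w).
Proof.
rewrite /reduced /winv rev_sorted sorted_map; apply: sub_sorted => a b /=.
by rewrite linvK; apply: contraNN => /eqP ->.
Qed.

Lemma winvK : involutive winv.
Proof. by move=> w; rewrite /winv map_rev revK mapK //; exact: linvK. Qed.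

Lemma reduce_cat_rcons u a v :
  reduce_cat (rcons u a) v = reduce_cat u (cons_reduced a v).
Proof. by rewrite /reduce_cat foldr_rcons. Qed.

Lemma winv_catl w v : reduced v -> reduce_cat (winv w) (reduce_cat w v) = v.
Proof.
move=> rv; elim: w => //= a w IHw.
rewrite /winv /= rev_cons reduce_cat_rcons -[a in cons_reduced a _]linvK.
by rewrite linvK -{2}[a]linvK cons_reducedK //; exact: reduce_catP.
Qed.

Definition free_group : Type := {w : word n | reduced w}.

HB.instance Definition _ := SubChoice.on free_group.

Definition fg_one : free_group := exist _ [::] isT.
Definition fg_mul (x y : free_group) : free_group :=
  exist _ (reduce_cat (sval x) (sval y)) (reduce_catP (sval x) (svalP y)).
Definition fg_inv (x : free_group) : free_group :=
  exist _ (winv (sval x)) (winvP (svalP x)).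

Lemma fg_mulA : associative fg_mul.
Proof. by move=> x y z; apply: val_inj; exact: reduce_catA (svalP z). Qed.

Lemma fg_mul1g : left_id fg_one fg_mul.
Proof. by move=> x; apply: val_inj. Qed.

Lemma fg_mulg1 : right_id fg_one fg_mul.
Proof. by move=> x; apply: val_inj; exact: reduce_cats0 (svalP x). Qed.

Lemma fg_mulVg : left_inverse fg_one fg_inv fg_mul.
Proof.
move=> x; apply: val_inj => /=.
by rewrite -[X in reduce_cat _ X](reduce_cats0 (svalP x)) winv_catl.
Qed.

Lemma fg_mulgV : right_inverse fg_one fg_inv fg_mul.
Proof.
move=> x; have <- := fg_mulVg (fg_inv x); congr fg_mul.
by apply: val_inj; rewrite /= winvK.
Qed.

HB.instance Definition _ := isGroup.Build free_group
  fg_mulA fg_mul1g fg_mulg1 fg_mulVg fg_mulgV.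

Definition fg_gen (i : 'I_n) : free_group := exist _ [:: (i, false)] isT.

(* The element of F_n represented by a word that need not be reduced. *)
Definition word_val w : free_group :=
  \prod_(a <- w) (if a.2 then (fg_gen a.1)^-1 else fg_gen a.1).

Lemma fg_word_val (x : free_group) : x = word_val (sval x).
Proof.
rewrite /word_val; apply: val_inj; case: x => w /= rw.
elim: w rw => [|a w IHw] rw; first by rewrite big_nil.
rewrite big_cons /= -IHw; last exact: path_sorted rw.
by case: a rw => i [] rw /=; rewrite cons_reducedE.
Qed.

End FreeGroup.

Lemma free_group_universal (n : nat) (G : groupType) (f : 'I_n -> G) :
  exists phi : {multiplicative free_group n -> G},
    (forall i, phi (fg_gen i) = f i) /\
    (forall psi : {multiplicative free_group n -> G},
      (forall i, psi (fg_gen i) = f i) -> psi =1 phi).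
Proof.
pose fl (a : letter n) := if a.2 then (f a.1)^-1 else f a.1.
pose g (w : word n) := \prod_(a <- w) fl a.
have flV a : fl (linv a) = (fl a)^-1.
  by case: a => i []; rewrite /fl /= ?invgK.
have gc a w : g (cons_reduced a w) = fl a * g w.
  rewrite /g; case: w => [|b w] /=; first by rewrite big_cons.
  case: eqP => [->|_]; last by rewrite big_cons.
  by rewrite big_cons flV mulVKg.
have gM : {morph (fun x : free_group n => g (sval x)) : x y / x * y}.
  move=> [u ru] [v rv] /=; elim: u {ru} => [|a u IHu] /=.
    by rewrite /g big_nil mul1g.
  by rewrite gc IHu mulgA /g big_cons.
pose phiM := isMultiplicative.Build _ _ (fun x : free_group n => g (sval x)) gM.
pose phi : {multiplicative free_group n -> G} :=
  HB.pack (fun x : free_group n => g (sval x)) phiM.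
exists phi; split=> [i|psi psif x]; first by rewrite /= /g big_seq1.
have psi1 : psi 1 = 1.
  by apply: (mulgI (psi 1)); rewrite -gmulfM !mulg1.
have psiV y : psi y^-1 = (psi y)^-1.
  by apply: (mulgI (psi y)); rewrite -gmulfM !mulgV.
rewrite /= {1}(fg_word_val x) /word_val /g; case: x => w /= _.
elim: w => [|a w IHw]; first by rewrite !big_nil.
rewrite !big_cons gmulfM IHw; congr (_ * _).
by rewrite /fl; case: (a.2); rewrite ?psiV psif.
Qed.

Section Subgroups.
Variable G : groupType.
Implicit Types (A H K : set G).

Record is_subgroup H : Prop := IsSubgroup {
  subgroup1 : H 1;
  subgroupM : forall x y, H x -> H y -> H (x * y);
  subgroupV : forall x, H x -> H x^-1 }.

Definition generated A : set G := smallest is_subgroup A.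

Definition finitely_generated H : Prop :=
  exists A, finite_set A /\ H = generated A.

Definition join H K : set G := generated (H `|` K).

Definition is_complement H K : Prop :=
  [/\ is_subgroup K, join H K = setT & H `&` K = [set 1]].

Definition has_nontrivial_complement H : Prop :=
  exists K, is_complement H K /\ K <> [set 1].

Definition left_coset H (x : G) : set G := [set x * h | h in H].

Definition infinite_index H : Prop := infinite_set (range (left_coset H)).

End Subgroups.

(* Algorithms are programs of a combinator variant of Jones's one-variable
   WHILE language (language I of "Computability and Complexity from a
   Programming Perspective", 1997), a Turing-complete language computing partial
   functions on binary trees: a program reads one tree and returns one tree. *)

Inductive tree : Type := Nil | Cons of tree & tree.

Definition hd (t : tree) : tree := if t is Cons l _ then l else Nil.
Definition tl (t : tree) : tree := if t is Cons _ r then r else Nil.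

Inductive prog : Type :=
| PId
| PNil
| PHd
| PTl
| PCons of prog & prog
| PSeq of prog & prog
| PIf of prog & prog & prog
| PWhile of prog & prog.

(* [eval p s t]: on input [s], the program [p] halts with output [t].
   [Nil] is the only tree that tests as false. *)
Inductive eval : prog -> tree -> tree -> Prop :=
| EId s : eval PId s s
| ENil s : eval PNil s Nil
| EHd s : eval PHd s (hd s)
| ETl s : eval PTl s (tl s)
| ECons p q s t u :
    eval p s t -> eval q s u -> eval (PCons p q) s (Cons t u)
| ESeq p q s t u :
    eval p s t -> eval q t u -> eval (PSeq p q) s u
| EIfTrue c p q s l r t :
    eval c s (Cons l r) -> eval p s t -> eval (PIf c p q) s t
| EIfFalse c p q s t :
    eval c s Nil -> eval q s t -> eval (PIf c p q) s t
| EWhileStop c p s :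
    eval c s Nil -> eval (PWhile c p) s s
| EWhileLoop c p s l r t u :
    eval c s (Cons l r) -> eval p s t -> eval (PWhile c p) t u ->
    eval (PWhile c p) s u.

Lemma eval_det p s t : eval p s t -> forall t', eval p s t' -> t = t'.
Proof.
elim=> {p s t}.
- by move=> s t' e; inversion e.
- by move=> s t' e; inversion e.
- by move=> s t' e; inversion e.
- by move=> s t' e; inversion e.
- move=> p q s t u _ IHp _ IHq t' e; inversion e; subst.
  by congr Cons; [apply: IHp | apply: IHq].
- move=> p q s t u _ IHp _ IHq t' e; inversion e as [| | | | |? ? ? v ? ep eq| | | |].
  by subst; apply: IHq; rewrite (IHp _ ep).
- move=> c p q s l r t _ IHc _ IHp t' e; inversion e; subst; first exact: IHp.
  by have := IHc Nil ltac:(assumption).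
- move=> c p q s t _ IHc _ IHq t' e; inversion e; subst; last exact: IHq.
  by have := IHc (Cons l r) ltac:(assumption).
- move=> c p s _ IHc t' e; inversion e; subst; first by [].
  by have := IHc (Cons l r) ltac:(assumption).
- move=> c p s l r t u _ IHc _ IHp _ IHw t' e.
  inversion e as [| | | | | | | |? ? ? ec|? ? ? l' r' v ? ec ep ew]; subst.
    by have := IHc Nil ec.
  by apply: IHw; rewrite (IHp _ ep).
Qed.

Definition enc_bool (b : bool) : tree := if b then Cons Nil Nil else Nil.

Definition enc_nat (k : nat) : tree := iter k (Cons Nil) Nil.

Definition enc_seq (T : Type) (enc : T -> tree) (s : seq T) : tree :=
  foldr (fun x t => Cons (enc x) t) Nil s.

Definition enc_letter (n : nat) (a : letter n) : tree :=
  Cons (enc_nat a.1) (enc_bool a.2).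

Definition enc_words (n : nat) (ws : seq (word n)) : tree :=
  enc_seq (enc_seq (@enc_letter n)) ws.

(* [p] decides [Q] on the inputs satisfying the promise [P]; nothing is
   required of [p] on other inputs. *)
Definition decides (T : Type) (enc : T -> tree) (P Q : T -> Prop) (p : prog) :
    Prop :=
  forall x, P x -> exists b : bool, eval p (enc x) (enc_bool b) /\ (b <-> Q x).

Definition generated_by_words (n : nat) (ws : seq (word n)) :
    set (free_group n) :=
  generated ((@word_val n) @` [set` ws]).

(* Main.v *)
(* A folded, finite, connected graph whose loops at the base vertex spell H
   (Stallings) is obtained by gluing petals and merging vertices.  If every
   letter leaves every vertex, the vertices represent all cosets of H and the
   index is finite; since F_n is torsion-free, the powers of a nontrivial element
   of a complement represent infinitely many cosets, so H has none.
   Otherwise some reduced word c can be read from no vertex, hence is a factor of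
   no element of H.  Take h in H, h <> 1, put x_0 = 1, let x_1, ..., x_n be the
   basis, and let K be generated by the elements h^i g x_i with g = a^N c a^N,
   where a is a letter with another index than the end letters of c and N is
   large.  In a reduced product of these generators every c survives, so K meets
   H trivially, while H and K generate h^0 g x_0 = g and then every x_i.  In rank
   one the index is always finite.  Saturation of the folded graph is what the
   program tests. *)

Require Import Defs.
From mathcomp Require Import all_boot all_classical.

Set Implicit Arguments.
Unset Strict Implicit.
Unset Printing Implicit Defensive.

Local Open Scope classical_set_scope.
Local Open Scope group_scope.

(** * Reduced words *)

Section Words.
Variable n : nat.
Implicit Types (a b x y : letter n) (u v w z : word n).

Lemma word_val_nil : word_val [::] = 1 :> free_group n.
Proof. by rewrite /word_val big_nil. Qed.

Lemma word_val_cat u v : word_val (u ++ v) = word_val u * word_val v.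
Proof. by rewrite /word_val big_cat. Qed.

Lemma sval_word_val w : sval (word_val w) = reduce_cat w [::].
Proof.
elim: w => [|a w IHw]; first by rewrite word_val_nil.
rewrite -cat1s word_val_cat /= IHw /word_val big_seq1.
by case: a => i [].
Qed.

Lemma reduced_word_valK w : reduced w -> sval (word_val w) = w.
Proof. by move=> rw; rewrite sval_word_val reduce_cats0. Qed.

Lemma winv_cons a w : winv (a :: w) = rcons (winv w) (linv a).
Proof. by rewrite /winv /= rev_cons. Qed.

Lemma winv_cat u v : winv (u ++ v) = winv v ++ winv u.
Proof. by rewrite /winv map_cat rev_cat. Qed.

Lemma word_val_winv w : word_val (winv w) = (word_val w)^-1.
Proof.
elim: w => [|a w IHw]; first by rewrite word_val_nil invg1.
rewrite winv_cons -cats1 word_val_cat IHw -(cat1s a) word_val_cat invgM.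
by congr (_ * _); rewrite /word_val !big_seq1; case: a => i []; rewrite /= ?invgK.
Qed.

Lemma winv_nseq k x : winv (nseq k x) = nseq k (linv x).
Proof. by rewrite /winv map_nseq rev_nseq. Qed.

Lemma reduced_catl u v : reduced (u ++ v) -> reduced u.
Proof. by rewrite /reduced => /cat_sorted2[]. Qed.

Lemma reduced_catr u v : reduced (u ++ v) -> reduced v.
Proof. by rewrite /reduced => /cat_sorted2[]. Qed.

Lemma reduced_cat u a b v :
  reduced (rcons u a ++ b :: v) =
    [&& reduced (rcons u a), b != linv a & reduced (b :: v)].
Proof. by rewrite /reduced cat_rcons sorted_cat_cons. Qed.

Lemma linv_neq a : linv a != a.
Proof. by case: a => i e; rewrite /linv xpair_eqE /= eqxx; case: e. Qed.

Lemma reduced_nseq k x : reduced (nseq k x).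
Proof.
elim: k => [|[|k] IHk] //; rewrite /reduced /= eq_sym linv_neq.
exact: IHk.
Qed.

Lemma eq_idx x y : x.1 = y.1 -> x = y \/ x = linv y.
Proof.
case: x y => [i e] [j f] /= ->; rewrite /linv /=.
by case: e f => [] []; [left|right|right|left].
Qed.

Lemma reduced_winv w : reduced (winv w) = reduced w.
Proof. by apply/idP/idP => [/winvP|/winvP//]; rewrite winvK. Qed.

(** * Runs of letters of one index, and powers that absorb short words *)

Section Index.
Variable i : 'I_n.

(** Both values of [e] require a nonempty word: [false] means that a first letter exists and has an
    index other than [i]. *)
Definition starts (e : bool) w := if w is x :: _ then (x.1 == i) == e else false.
Definition ends (e : bool) w := starts e (rev w).

Lemma starts_cat e u v : starts e u -> starts e (u ++ v).
Proof. by case: u. Qed.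

Lemma ends_cat e u v : ends e v -> ends e (u ++ v).
Proof. by rewrite /ends rev_cat; exact: starts_cat. Qed.

Lemma ends_rcons e u x : ends e (rcons u x) = ((x.1 == i) == e).
Proof. by rewrite /ends rev_rcons. Qed.

Lemma starts_winv e w : starts e (winv w) = ends e w.
Proof.
by elim/last_ind: w => // w x _; rewrite /winv map_rcons rev_rcons ends_rcons.
Qed.

Lemma ends_winv e w : ends e (winv w) = starts e w.
Proof. by rewrite -starts_winv winvK. Qed.

Lemma reduced_cat_ends e u v : reduced u -> reduced v ->
  ends e u -> starts (~~ e) v -> reduced (u ++ v).
Proof.
elim/last_ind: u => // u a _ ru rv; rewrite ends_rcons => /eqP ea.
case: v rv => // b v rv /= /eqP eb; rewrite reduced_cat ru rv andbT /=.
by apply/eqP => ab; move: eb; rewrite ab /= ea; case: e {ea}.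
Qed.

Lemma starts_nseq e k x : x.1 = i -> starts e (nseq k x) = (0 < k) && e.
Proof. by case: k => //= k ->; rewrite eqxx. Qed.

Lemma ends_nseq e k x : x.1 = i -> ends e (nseq k x) = (0 < k) && e.
Proof. by rewrite /ends rev_nseq; exact: starts_nseq. Qed.

Lemma word_val_nseqV j k x : j <= k ->
  word_val (nseq k x ++ nseq j (linv x)) = word_val (nseq (k - j) x).
Proof.
move=> jk; rewrite -{1}(subnK jk) nseqD !word_val_cat -winv_nseq word_val_winv.
by rewrite mulgK.
Qed.

(** Letters of equal index are equal or inverse, so the copies of [y] lengthen [x^N] or cancel only
    [k < N] of its letters. *)
Lemma word_val_nseq_absorb N k x y : x.1 = i -> y.1 = i -> k < N ->
  exists2 j, 0 < j & word_val (nseq N x ++ nseq k y) = word_val (nseq j x).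
Proof.
move=> xi yi kN; have [->|->] := @eq_idx y x (etrans yi (esym xi)).
  by exists (N + k); rewrite ?nseqD // addn_gt0 (leq_trans _ kN).
by exists (N - k); rewrite ?subn_gt0 // word_val_nseqV // ltnW.
Qed.

(** Neighbouring letters of equal index in a reduced word are equal, so the leading run of index [i]
    is a power of one letter. *)
Lemma split_lead w : reduced w ->
  exists k y v, [/\ w = nseq k y ++ v, y.1 = i & v = [::] \/ starts false v].
Proof.
elim: w => [|a w IHw] rw; first by exists 0, (i, false), [::]; split=> //; left.
have [ai|ai] := eqVneq a.1 i; last first.
  by exists 0, (i, false), (a :: w); split=> //; right; rewrite /= (negbTE ai).
have [[|k] [y [v [ew yi vP]]]] := IHw (path_sorted rw).
  by exists 1%N, a, v; rewrite ew.
exists k.+2, y, v; split=> //; rewrite ew /=; congr (_ :: _).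
have [//|ya] := @eq_idx a y (etrans ai (esym yi)).
by move: rw; rewrite ew ya /reduced /= linvK eqxx.
Qed.

Lemma split_trail w : reduced w ->
  exists k y v, [/\ w = v ++ nseq k y, y.1 = i & v = [::] \/ ends false v].
Proof.
move=> rw; have [k [y [v [ew yi vP]]]] := split_lead (winvP rw).
exists k, (linv y), (winv v); split=> //; last first.
  by case: vP => [->|vP]; [left | right; rewrite ends_winv].
by rewrite -winv_nseq -winv_cat -ew winvK.
Qed.

(** The leading run of index [i] in [z] is too short to exhaust [x^N], and the rest of [z] starts
    with another index, so cancellation stops there. *)
Lemma absorb_left N x z : x.1 = i -> reduced z -> size z < N ->
  exists w, [/\ word_val (nseq N x ++ z) = word_val w, reduced w &
    starts true w].
Proof.
move=> xi rz zN; have [k [y [v [ez yi vP]]]] := split_lead rz.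
have kN : k < N.
  by apply: leq_ltn_trans zN; rewrite ez size_cat size_nseq leq_addr.
have [j j0 jE] := word_val_nseq_absorb xi yi kN.
exists (nseq j x ++ v); split.
- by rewrite ez catA word_val_cat jE word_val_cat.
- case: vP => [->|vP]; first by rewrite cats0 reduced_nseq.
  apply: (@reduced_cat_ends true); rewrite ?reduced_nseq ?ends_nseq ?j0 //.
  by move: rz; rewrite ez => /reduced_catr.
- by apply: starts_cat; rewrite starts_nseq ?j0.
Qed.

Lemma absorb_right N x z : x.1 = i -> reduced z -> size z < N ->
  exists w, [/\ word_val (z ++ nseq N x) = word_val w, reduced w & ends true w].
Proof.
move=> xi rz zN.
have [|||w [ew rw sw]] := @absorb_left N (linv x) (winv z) => //.
- exact: winvP.
- by rewrite /winv size_rev size_map.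
exists (winv w); split; [|exact: winvP|by rewrite ends_winv].
by rewrite word_val_winv -ew -winv_nseq -winv_cat word_val_winv invgK.
Qed.

(** The last hypothesis excludes [x^N x^-N], which would vanish. If [z] is a run of index [i], the
    product is a nonzero power of a letter; otherwise [z] has a middle part that begins and ends
    with other indices, and the runs around it are absorbed separately. *)
Lemma absorb_both N x y z : x.1 = i -> y.1 = i -> reduced z -> size z < N ->
  (y = linv x -> z <> [::]) ->
  exists w, [/\ word_val (nseq N x ++ z ++ nseq N y) = word_val w, reduced w,
    starts true w & ends true w].
Proof.
move=> xi yi rz zN xyz; have [k [t [v [ez ti vP]]]] := split_lead rz.
have kN : k < N.
  by apply: leq_ltn_trans zN; rewrite ez size_cat size_nseq leq_addr.
have [v0|v0] := eqVneq v [::].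
  move: ez; rewrite v0 cats0 => {v v0 vP} ez.
  have [m m0 mE] : exists2 m, 0 < m & exists2 s : letter n, s.1 = i &
      word_val (nseq N x ++ z ++ nseq N y) = word_val (nseq m s).
    (* For [y = x] the outer letters outnumber the [k] letters of [z]; for [y = x^-1] they cancel
       each other and [t^k] is left. *)
    have [yx|yx] := @eq_idx y x (etrans yi (esym xi)).
      have [j j0 jE] := word_val_nseq_absorb xi ti kN.
      exists (j + N); first by rewrite addn_gt0 j0.
      by exists x; rewrite // catA word_val_cat ez jE yx nseqD word_val_cat.
    have k0 : 0 < k by case: k ez {kN} => // ez; case: (xyz yx).
    exists k => //; exists t => //.
    rewrite ez; have [->|->] := @eq_idx t x (etrans ti (esym xi)).
      by rewrite yx catA -nseqD word_val_nseqV ?leq_addr // addKn.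
    rewrite yx -nseqD addnC nseqD catA word_val_cat word_val_nseqV // subnn.
    by rewrite word_val_nil mul1g.
  case: mE => s si sE; exists (nseq m s).
  by rewrite sE reduced_nseq starts_nseq ?ends_nseq ?m0.
have sv : starts false v by case: vP => // v0'; rewrite v0' in v0.
have rv : reduced v by move: rz; rewrite ez => /reduced_catr.
have [l [s [u [ev si uP]]]] := split_trail rv.
have su : starts false u.
  move: sv; rewrite ev; case: (u) => //.
  by rewrite starts_nseq // andbF.
have eu : ends false u by case: uP su => // ->.
have lN : l < N.
  apply: leq_ltn_trans zN; rewrite ez ev !size_cat !size_nseq.
  by rewrite addnA leq_addl.
have [j j0 jE] := word_val_nseq_absorb xi ti kN.
have [m m0 mE] : exists2 m, 0 < m &
    word_val (nseq l s ++ nseq N y) = word_val (nseq m y).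
  have [|||m m0 mE] := @word_val_nseq_absorb N l (linv y) (linv s) => //.
  exists m => //; apply: invg_inj.
  by rewrite -!word_val_winv winv_cat !winv_nseq.
exists (nseq j x ++ u ++ nseq m y); split.
- have -> : nseq N x ++ z ++ nseq N y =
      (nseq N x ++ nseq k t) ++ u ++ (nseq l s ++ nseq N y).
    by rewrite ez ev !catA.
  by rewrite word_val_cat [word_val (u ++ _)]word_val_cat jE mE -!word_val_cat.
- apply: (@reduced_cat_ends true); rewrite ?reduced_nseq ?ends_nseq ?j0 //.
    apply: (@reduced_cat_ends false); rewrite ?reduced_nseq ?starts_nseq ?m0 //.
    by move: rv; rewrite ev => /reduced_catl.
  exact: starts_cat.
- by apply: starts_cat; rewrite starts_nseq ?j0.
- by do 2!apply: ends_cat; rewrite ends_nseq ?m0.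
Qed.

End Index.

Lemma expg_word_val w k : word_val w ^+ k = word_val (flatten (nseq k w)).
Proof. by elim: k => [|k IHk]; rewrite ?word_val_nil // expgS IHk /= word_val_cat. Qed.

(** Induction on length. If the last letter is inverse to the first, conjugation passes to a shorter
    word; otherwise copies of the word concatenate without cancellation. *)
Lemma torsion_free (x : free_group n) k : x <> 1 -> x ^+ k.+1 <> 1.
Proof.
have [m] := ubnP (size (sval x)); elim: m x => // m IHm x xm.
case ex: (sval x) => [|a w]; first by case; apply: val_inj; rewrite /= ex.
move=> _ xk; have rx := svalP x; rewrite ex in rx.
have xE : x = word_val (a :: w) by rewrite -ex -fg_word_val.
case/lastP: w => [|w b] in ex rx xE *.
  move: xk; rewrite xE expg_word_val => /(congr1 sval).
  have -> : flatten (nseq k.+1 [:: a]) = nseq k.+1 a.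
    by elim: k.+1 => // j; rewrite /= => ->.
  by rewrite reduced_word_valK // reduced_nseq.
have [ba|ba] := eqVneq b (linv a).
  pose y := word_val w; have rw : reduced w.
    by move: rx; rewrite -cat1s -cats1 => /reduced_catr/reduced_catl.
  have xy : x = word_val [:: a] * y * (word_val [:: a])^-1.
    rewrite xE -cat1s -cats1 !word_val_cat ba mulgA -word_val_winv.
    by rewrite winv_cons.
  have y1 : y <> 1.
    move=> y1; move: xy; rewrite y1 mulg1 mulgV => x1.
    by move: ex; rewrite x1.
  apply: (IHm y _ y1).
    by rewrite (reduced_word_valK rw); move: xm; rewrite ex /= size_rcons ltnS => /ltnW.
  move: xk; rewrite xy; have -> : forall t : free_group n,
      (t * y * t^-1) ^+ k.+1 = t * y ^+ k.+1 * t^-1.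
    move=> t; elim: k.+1 => [|j IHj]; first by rewrite mulg1 mulgV.
    by rewrite !expgS IHj !mulgA mulgVK.
  by move/(congr1 (fun t => (word_val [:: a])^-1 * t * word_val [:: a]));
     rewrite !mulgA mulVg mul1g mulgVK mulg1 mulVg.
suff rk : reduced (flatten (nseq k.+1 (a :: rcons w b))).
  by move: xk; rewrite xE expg_word_val => /(congr1 sval); rewrite reduced_word_valK.
elim: k {xk IHm} => [|k IHk]; first by rewrite /= cats0.
have := reduced_cat (a :: w) b a (rcons w b ++ flatten (nseq k (a :: rcons w b))).
rewrite rcons_cons rx andTb => redE; apply: (etrans redE).
apply/andP; split; last exact: IHk.
by apply: contraNneq ba => ->; rewrite linvK.
Qed.

End Words.

(** * Subgroups and cosets *)

Section Subgroups.
Variable G : groupType.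
Implicit Types (A H M : set G).

Lemma generatedP A x :
  generated A x <-> forall M, is_subgroup M -> A `<=` M -> M x.
Proof.
by split=> [Ax M sM AM|Ax M [sM AM]]; [apply: Ax | apply: Ax].
Qed.

Lemma sub_generated A : A `<=` generated A.
Proof. by move=> x Ax; apply/generatedP => M _; exact. Qed.

Lemma generated_subgroup A : is_subgroup (generated A).
Proof.
split; first by apply/generatedP => M [].
  move=> x y /generatedP Ax /generatedP Ay; apply/generatedP => M sM AM.
  by apply: (subgroupM sM); [apply: Ax | apply: Ay].
move=> x /generatedP Ax; apply/generatedP => M sM AM.
by apply: (subgroupV sM); apply: Ax.
Qed.

Lemma subgroupX H x k : is_subgroup H -> H x -> H (x ^+ k).
Proof.
move=> sH Hx; elim: k => [|k IHk]; first exact: subgroup1.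
by rewrite expgS; apply: (subgroupM sH).
Qed.

Lemma subgroup_neq1 H : is_subgroup H -> H <> [set 1] ->
  exists2 h, H h & h <> 1.
Proof.
move=> sH H1; apply: contrapT => H0; apply: H1; apply/seteqP; split=> x /=.
  by move=> Hx; apply: contrapT => x1; apply: H0; exists x.
by move=> ->; exact: subgroup1.
Qed.

Lemma left_coset_eq H x y : is_subgroup H ->
  left_coset H x = left_coset H y <-> H (x^-1 * y).
Proof.
move=> sH; split=> [xy|Hxy].
  have : left_coset H y y by exists 1; rewrite ?mulg1 //; exact: subgroup1.
  by rewrite -xy => -[h Hh <-]; rewrite mulKg.
apply/seteqP; split=> _ [h Hh <-].
  exists ((x^-1 * y)^-1 * h); last by rewrite invgM invgK !mulgA mulgV mul1g.
  by apply: (subgroupM sH) => //; apply: (subgroupV sH).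
exists (x^-1 * y * h); last by rewrite !mulgA mulgV mul1g.
exact: (subgroupM sH).
Qed.

End Subgroups.

Section FreeGroupSubgroups.
Variable n : nat.
Implicit Types (a : letter n) (w c : word n) (H : set (free_group n)).

Lemma complement_infinite_index H : is_subgroup H ->
  has_nontrivial_complement H -> infinite_index H.
Proof.
move=> sH [K [[sK _ HK] K1]]; have [k Kk k1] := subgroup_neq1 sK K1.
have f_inj : {in [set: nat] &, injective (fun i => left_coset H (k ^+ i))}.
  suff lt_neq i j : i < j -> left_coset H (k ^+ i) <> left_coset H (k ^+ j).
    by move=> i j _ _ eij; have [/lt_neq|/lt_neq|//] := ltngtP i j; rewrite eij.
  move=> ij /(left_coset_eq _ _ sH); rewrite -(subnKC ij) addSnnS expgnDr mulKg.
  move=> Hk; apply: (@torsion_free n k (j - i.+1)) => //.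
  have : (H `&` K) (k ^+ (j - i.+1).+1) by split=> //; apply: (subgroupX _ sK).
  by rewrite HK.
move=> fin; apply: infinite_nat.
rewrite -(eq_finite_set (inj_card_eq f_inj)); apply: sub_finite_set fin.
by move=> _ [i _ <-]; exists (k ^+ i).
Qed.

(** All letters have the same index, so every element is a power of one letter [g]. A nontrivial
    element of [H] yields [g^p] in [H] with [p > 0], and exponents matter only modulo [p]. *)
Lemma rank_le1_finite_index H : n <= 1 -> is_subgroup H -> H <> [set 1] ->
  ~ infinite_index H.
Proof.
move=> n1 sH H1; have [h Hh h1] := subgroup_neq1 sH H1; apply.
have [a ah] : exists a, a \in sval h.
  case eh: (sval h) => [|a w]; last by exists a; rewrite mem_head.
  by case: h1; apply: val_inj; rewrite /= eh.
have ord_eq0 (i : 'I_n) : val i = 0.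
  by apply/eqP; rewrite -leqn0 -ltnS (leq_trans (ltn_ord i)).
have idx (x y : letter n) : x.1 = y.1.
  by apply: val_inj; rewrite [LHS]ord_eq0 [RHS]ord_eq0.
pose g := word_val [:: a].
have gX k : word_val (nseq k a) = g ^+ k.
  elim: k => [|k IHk]; first exact: word_val_nil.
  by rewrite expgS -IHk -word_val_cat.
have pow x : exists k, x = g ^+ k \/ x = (g ^+ k)^-1.
  have [k [y [v [ex yi vP]]]] := split_lead a.1 (svalP x).
  have v0 : v = [::].
    by case: vP => // ; case: v {ex} => // b v /=; rewrite (idx b a) eqxx.
  exists k; rewrite (fg_word_val x) ex v0 cats0 -gX.
  by have [->|->] := eq_idx yi; [left | right; rewrite -word_val_winv winv_nseq].
have [p p0 Hp] : exists2 p, 0 < p & H (g ^+ p).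
  have [[|p] hp] := pow h; first by case: h1; case: hp => ->; rewrite ?invg1.
  exists p.+1 => //; case: hp => hp; first by rewrite -hp.
  by rewrite -[g ^+ _]invgK -hp; apply: (subgroupV sH).
have cosetM x y : H y -> left_coset H (x * y) = left_coset H x.
  by move=> Hy; apply/esym/left_coset_eq; rewrite ?mulKg.
apply: (sub_finite_set (B := (fun r => left_coset H (g ^+ r)) @` `I_p)).
  have posP k : ((fun r => left_coset H (g ^+ r)) @` `I_p) (left_coset H (g ^+ k)).
    exists (k %% p); first by rewrite /= ltn_mod.
    rewrite [in RHS](divn_eq k p) addnC expgnDr cosetM // mulnC expgnA.
    exact: subgroupX.
  move=> _ [x _ <-]; have [k [->|->]] := pow x; first exact: posP.
  (* A negative power becomes the power [k * p - k] times an element of [H]; [p > 0] makes the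
     subtraction exact. *)
  have -> : (g ^+ k)^-1 = g ^+ (k * p - k) * ((g ^+ p) ^+ k)^-1.
    rewrite -expgnA [(p * k)%N]mulnC -[in X in _ * X^-1](subnKC (leq_pmulr k p0)).
    by rewrite expgnDr invgM mulgA mulgV mul1g.
  by rewrite cosetM //; apply: (subgroupV sH); apply: subgroupX.
exact/finite_image/finite_II.
Qed.

End FreeGroupSubgroups.

(** * A complement from an avoided word *)

Lemma gmulf_word_val (m : nat) (G : groupType)
    (phi : {multiplicative free_group m -> G}) (w : word m) :
  phi (word_val w) =
    \prod_(a <- w) (if a.2 then (phi (fg_gen a.1))^-1 else phi (fg_gen a.1)).
Proof.
have phi1 : phi 1 = 1 by apply: (mulgI (phi 1)); rewrite -gmulfM !mulg1.
have phiV y : phi y^-1 = (phi y)^-1.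
  by apply: (mulgI (phi y)); rewrite -gmulfM !mulgV.
rewrite /word_val; elim: w => [|a w IHw]; first by rewrite !big_nil.
by rewrite !big_cons gmulfM IHw; case: a.2; rewrite ?phiV.
Qed.

Section Complement.
Variables (n : nat) (H : set (free_group n)).
Hypotheses (n_gt1 : 1 < n) (sH : is_subgroup H) (H_neq1 : H <> [set 1]).

Section Separated.
Variables (i0 : 'I_n) (h : free_group n) (c : word n).
Hypotheses (Hh : H h) (h_neq1 : h <> 1) (red_c : reduced c).
Hypotheses (c_start : starts i0 false c) (c_end : ends i0 false c).
Hypothesis c_avoid : forall x u v, H x -> sval x <> u ++ c ++ v.

(** Index [ord0] stands for the extra [x_0 = 1], and the other indices are the basis shifted by one.
    A letter [(i, e)] of rank [n.+1] names the generator [h^i g x_i] or, for [e = true], its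
    inverse. *)
Let lX (i : 'I_n.+1) : word n := if unlift ord0 i is Some j then [:: (j, false)] else [::].
Let lH (i : 'I_n.+1) : word n := sval (h ^+ i).

(** [outer] is the left factor and [inner] the right one: inverting a generator makes [h^i] and
    [x_i] trade places. *)
Let outer (l : letter n.+1) : word n := if l.2 then winv (lX l.1) else lH l.1.
Let inner (l : letter n.+1) : word n := if l.2 then winv (lH l.1) else lX l.1.
Let core (l : letter n.+1) : word n := if l.2 then winv c else c.
Let spike (l : letter n.+1) : letter n := (i0, l.2).

Let mid (l m : letter n.+1) : free_group n := word_val (inner l ++ outer m).

(* Exceeds the length of every word that a power of a letter has to absorb. *)
Let N : nat := (\max_(p : letter n.+1 * letter n.+1) size (sval (mid p.1 p.2))
  + \max_(l : letter n.+1) (size (outer l) + size (inner l))).+1.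

Let head l : word n := outer l ++ nseq N (spike l).
Let tail l : word n := nseq N (spike l) ++ inner l.
Let U l : word n := head l ++ core l ++ tail l.

Let size_mid l m : size (sval (mid l m)) < N.
Proof.
by rewrite ltnS; apply: leq_trans (leq_addr _ _); apply: (leq_bigmax (l, m)).
Qed.

Let size_sides l : size (outer l) < N /\ size (inner l) < N.
Proof.
suff sumN : size (outer l) + size (inner l) < N.
  by split; apply: leq_ltn_trans sumN; [apply: leq_addr | apply: leq_addl].
rewrite ltnS; apply: leq_trans (leq_addl _ _).
exact: (leq_bigmax (F := fun l => size (outer l) + size (inner l)) l).
Qed.

Let red_lX i : reduced (lX i).
Proof. by rewrite /lX; case: unlift. Qed.

Let red_sides l : reduced (outer l) /\ reduced (inner l).
Proof.
have rH : reduced (lH l.1) := svalP (h ^+ l.1).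
by rewrite /outer /inner; case: l.2; rewrite ?reduced_winv.
Qed.

Let red_core l : reduced (core l).
Proof. by rewrite /core; case: l.2; rewrite ?reduced_winv. Qed.

Let core_start l : starts i0 false (core l).
Proof. by rewrite /core; case: l.2; rewrite ?starts_winv. Qed.

Let core_end l : ends i0 false (core l).
Proof. by rewrite /core; case: l.2; rewrite ?ends_winv. Qed.

Let U_inv i : word_val (U (i, true)) = (word_val (U (i, false)))^-1.
Proof.
rewrite -word_val_winv; congr word_val.
by rewrite /U /head /tail /core /inner /outer !winv_cat !winv_nseq -!catA.
Qed.

Let lX_inj : injective lX.
Proof.
move=> i j; rewrite /lX; case: unliftP => [i' ->|->]; case: unliftP => [j' ->|->] //.
by case=> ->.
Qed.

Let lH_inj : injective lH.
Proof.
suff lt_neq (i j : 'I_n.+1) : i < j -> lH i <> lH j.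
  move=> i j eij; apply: val_inj; have [/lt_neq|/lt_neq|//] := ltngtP i j.
    by rewrite eij.
  by rewrite eij.
move=> ij /val_inj /= eij; apply: (@torsion_free n h (j - i.+1)) => //.
by apply: (mulgI (h ^+ i)); rewrite -expgnDr -addSnnS subnKC // mulg1.
Qed.

(** Opposite spikes mean opposite signs, and then the middle is [x_i x_j^-1] or [h^-i h^j] with
    distinct [i] and [j]; for the powers of [h] torsion-freeness is what separates them. *)
Let mid_neq1 l m : m != linv l -> spike m = linv (spike l) -> mid l m <> 1.
Proof.
case: l m => [i e] [j f] /=; rewrite /spike /linv /= => ml [fe].
rewrite /mid word_val_cat /inner /outer /= {}fe in ml *.
have ji : j != i by apply: contraNneq ml => ->.
case: e {ml} => /=; rewrite word_val_winv => mid1.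
  move: ji; rewrite (@lH_inj j i) ?eqxx //; congr sval.
  rewrite /lH -!fg_word_val in mid1.
  by rewrite -[RHS]mulg1 -mid1 mulVKg.
move: ji; rewrite (@lX_inj j i) ?eqxx //.
rewrite -[lX j]reduced_word_valK // -[lX i]reduced_word_valK //; congr sval.
by rewrite -[LHS]mul1g -mid1 mulgVK.
Qed.

(** Between consecutive cores the spikes absorb the middle into a word that begins and ends with
    index [i0], while cores begin and end with other indices, so no core cancels. The first [head]
    stays unabsorbed, so that the induction can join it to the preceding tail. *)
Let product_normal_form l s : reduced (l :: s) -> exists w,
  [/\ word_val (flatten (map U (l :: s))) = word_val (head l ++ core l ++ w),
    reduced w & starts i0 true w].
Proof.
elim: s l => [|m s IHs] l rs.
  have [w [ew rw sw]] := absorb_left (erefl (spike l).1) (red_sides l).2 (size_sides l).2.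
  by exists w; split=> //; rewrite /= cats0 /U catA word_val_cat ew -word_val_cat -catA.
have /andP[lm rms] : (m != linv l) && reduced (m :: s) := rs.
have [v [ev rv sv]] := IHs m rms.
have spikeE k : (spike k).1 = i0 by [].
have mid1 : spike m = linv (spike l) -> sval (mid l m) <> [::].
  by move=> lmE m0; apply: (mid_neq1 lm lmE); apply: val_inj.
have [y [ey ry sy ty]] := absorb_both (spikeE l) (spikeE m) (svalP (mid l m))
  (size_mid l m) mid1.
exists (y ++ core m ++ v); split.
- rewrite -[flatten _]/(U l ++ flatten (map U (m :: s))) word_val_cat ev.
  rewrite /U /tail /head !word_val_cat -ey !word_val_cat -(fg_word_val (mid l m)).
  by rewrite /mid word_val_cat !mulgA.
- apply: reduced_cat_ends ty _ => //; last exact: starts_cat.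
  exact: (reduced_cat_ends (red_core m) rv (core_end m)).
- exact: starts_cat.
Qed.

(** The first core survives in the reduced form. If it is [c^-1], the inverse element contains [c]
    and lies in [H] as well. *)
Let not_in_H l s : reduced (l :: s) -> ~ H (word_val (flatten (map U (l :: s)))).
Proof.
move=> rs; have [w [-> rw sw]] := product_normal_form rs.
have [p [ep rp sp]] := absorb_right (erefl (spike l).1) (red_sides l).1 (size_sides l).1.
rewrite word_val_cat ep -word_val_cat => Hx.
have rx : reduced (p ++ core l ++ w).
  apply: reduced_cat_ends sp _ => //; last exact: starts_cat.
  exact: (reduced_cat_ends (red_core l) rw (core_end l)).
move: (reduced_word_valK rx) Hx; rewrite {2}/core; case: l.2 => ex Hx.
  apply: (c_avoid (u := winv w) (v := winv p) (subgroupV sH Hx)).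
  by rewrite /= ex !winv_cat winvK catA.
exact: c_avoid Hx ex.
Qed.

(** [K] is the image of a free group of rank [n.+1] whose basis is sent to the generators. Every
    nontrivial element has its image outside [H], which gives both the trivial intersection and
    [K <> 1]. *)
Lemma separated_complement : has_nontrivial_complement H.
Proof.
have [phi [phiE _]] := free_group_universal (fun i => word_val (U (i, false))).
have phi_word w : phi (word_val w) = word_val (flatten (map U w)).
  rewrite gmulf_word_val; elim: w => [|[i e] w IHw].
    by rewrite big_nil -word_val_nil.
  rewrite big_cons IHw phiE.
  rewrite -[flatten (map U (_ :: _))]/(U (i, e) ++ flatten (map U w)) word_val_cat.
  by case: e; rewrite ?U_inv.
have phi1 : phi 1 = 1 by rewrite -(word_val_nil n.+1) phi_word -word_val_nil.
have phi_notin x : x <> 1 -> ~ H (phi x).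
  move=> x1; rewrite [x]fg_word_val phi_word.
  case ex: (sval x) (svalP x) => [|l s]; last exact: not_in_H.
  by case: x1; apply: val_inj; rewrite /= ex.
have gen_neq1 : fg_gen (ord0 : 'I_n.+1) <> 1 by move=> /(congr1 sval).
exists (range phi); split; last first.
  move=> K1; apply: (phi_notin _ gen_neq1).
  have : range phi (phi (fg_gen ord0)) by exists (fg_gen ord0).
  by rewrite K1 => ->; exact: subgroup1.
split.
- split; first by exists 1.
    by move=> _ _ [x _ <-] [y _ <-]; exists (x * y); rewrite ?gmulfM.
  move=> _ [x _ <-]; exists x^-1 => //.
  by apply: (mulgI (phi x)); rewrite -gmulfM !mulgV phi1.
- apply/seteqP; split=> // x _; apply/generatedP => M sM HKM.
  have MU i : M (word_val (U (i, false))).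
    by rewrite -phiE; apply: HKM; right; exists (fg_gen i).
  have MH i : M (h ^+ i) by apply: HKM; left; apply: subgroupX.
  pose g := word_val (nseq N (i0, false) ++ c ++ nseq N (i0, false)).
  have UE i : word_val (U (i, false)) = h ^+ i * g * word_val (lX i).
    rewrite -[U _]/((lH i ++ nseq N (i0, false)) ++
      c ++ nseq N (i0, false) ++ lX i) /g !word_val_cat.
    by rewrite /lH -fg_word_val !mulgA.
  (* At index [0] both side factors are trivial, so the generator is [g] itself; afterwards
     [(h^i g)^-1] isolates each [x_i]. *)
  have Mg : M g.
    move: (MU ord0); rewrite UE /lX; case: unliftP => [j /eqP|_].
      by rewrite (negbTE (neq_lift _ _)).
    by rewrite word_val_nil mulg1 -[h ^+ _]/1 mul1g.
  have MX i : M (word_val (lX i)).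
    have := subgroupM sM (subgroupV sM (subgroupM sM (MH i) Mg)) (MU i).
    by rewrite UE mulKg.
  have Mgen j : M (fg_gen j).
    move: (MX (lift ord0 j)); rewrite /lX liftK.
    by rewrite /word_val big_seq1.
  rewrite [x]fg_word_val /word_val; elim: (sval x) => [|a w IHw].
    by rewrite big_nil; exact: subgroup1.
  rewrite big_cons; apply: (subgroupM sM) => //.
  by case: a.2 => //; apply: (subgroupV sM).
- apply/seteqP; split=> x /=; last first.
    by move=> ->; split; [exact: subgroup1 | exists 1].
  move=> [Hx [y _ yx]]; apply: contrapT => x1; apply: (phi_notin y).
    by move=> y1; apply: x1; rewrite -yx y1.
  by rewrite yx.
Qed.

End Separated.

(** A letter of index [i1] is attached at each end of [c] that has index [i0]; a word with an
    avoided factor is avoided too. *)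
Lemma avoided_word_complement (c : word n) : reduced c ->
  (forall x u v, H x -> sval x <> u ++ c ++ v) -> has_nontrivial_complement H.
Proof.
move=> rc c_avoid.
pose i0 := Ordinal (ltnW n_gt1); pose i1 : 'I_n := Ordinal n_gt1.
have [c1 [v1 [c1E rc1 sc1 c10]]] : exists c1 v1, [/\ c1 = v1 ++ c, reduced c1,
    starts i0 false c1 & 0 < size c].
  (* The empty word is a factor of [1], so [c] is nonempty. *)
  case: c rc c_avoid => [|a c] rc c_avoid.
    by case: (@c_avoid 1 [::] [::] (subgroup1 sH)).
  have [ai|ai] := eqVneq a.1 i0.
    exists ((i1, false) :: a :: c), [:: (i1, false)]; split=> //.
    rewrite -[_ :: a :: c]/([:: (i1, false)] ++ a :: c).
    apply: (@reduced_cat_ends _ i0 false) => //=.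
    by rewrite ai eqxx.
  by exists (a :: c), [::]; split; rewrite //= (negbTE ai).
have [c2 [v2 [c2E rc2 sc2]]] : exists c2 v2, [/\ c2 = c1 ++ v2, reduced c2 &
    ends i0 false c2].
  case/lastP: c1 c1E rc1 sc1 => [//|c1 b] c1E rc1 sc1.
  have [bi|bi] := eqVneq b.1 i0.
    exists (rcons c1 b ++ [:: (i1, false)]), [:: (i1, false)]; split=> //.
      apply: (@reduced_cat_ends _ i0 true) => //.
      by rewrite ends_rcons bi eqxx.
    exact: ends_cat.
  by exists (rcons c1 b), [::]; split; rewrite ?cats0 // ends_rcons (negbTE bi).
have [h Hh h1] := subgroup_neq1 sH H_neq1.
apply: (@separated_complement i0 h c2) => //.
  by rewrite c2E; exact: starts_cat.
move=> x u v Hx; rewrite c2E c1E -!catA catA => xE.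
exact: (c_avoid x _ _ Hx xE).
Qed.

End Complement.

(** * Reading words in labelled graphs *)

(** [(v, (a, u))] is an edge from [v] to [u] with label [a]. A graph is a list of edges, without a
    separate list of vertices. *)
Definition edge (n : nat) : Type := (nat * (letter n * nat))%type.

Section Graphs.
Variable n : nat.
Implicit Types (a b : letter n) (w c : word n) (E : seq (edge n)).

Fixpoint reads E (v : nat) w (v' : nat) : Prop :=
  if w is a :: w' then exists2 u, (v, (a, u)) \in E & reads E u w' v' else v = v'.

Definition deterministic E : Prop :=
  forall v a u u', (v, (a, u)) \in E -> (v, (a, u')) \in E -> u = u'.

Definition involutive_edges E : Prop :=
  forall v a u, (v, (a, u)) \in E -> (u, (linv a, v)) \in E.

Definition connected_from E (o : nat) : Prop :=
  forall v a u, (v, (a, u)) \in E -> exists w, reads E o w v.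

(** Only sources of edges are tested, so the graph without edges counts as saturated. *)
Definition saturated E : bool :=
  all (fun a => all (fun e => has (fun e' => (e'.1 == e.1) && (e'.2.1 == a)) E) E)
    (enum {: 'I_n * bool}).

Lemma reads_cat E v w w' v' :
  reads E v (w ++ w') v' <-> exists2 u, reads E v w u & reads E u w' v'.
Proof.
elim: w v => [|a w IHw] v /=; first by split=> [|[u ->]] //; exists v.
split=> [[u vu /IHw[t ut tv']]|[t [u vu ut] tv']].
  by exists t => //; exists u.
by exists u => //; apply/IHw; exists t.
Qed.

Lemma reads_map E v w v' (f : nat -> nat) : reads E v w v' ->
  reads [seq (f e.1, (e.2.1, f e.2.2)) | e <- E] (f v) w (f v').
Proof.
elim: w v => [|a w IHw] v /=; first by move=> ->.
move=> [u vu /IHw uv']; exists (f u) => //.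
exact: (map_f (fun e : edge n => (f e.1, (e.2.1, f e.2.2))) vu).
Qed.

Lemma saturatedP E : saturated E ->
  forall v b u a, (v, (b, u)) \in E -> exists u', (v, (a, u')) \in E.
Proof.
move=> /allP sat v b u a vu.
have /allP/(_ _ vu)/hasP[[v' [a' u']] vu' /= /andP[/eqP vv /eqP aa]] :=
  sat a (mem_enum _ a).
by exists u'; rewrite -{1}vv -aa.
Qed.

Lemma not_saturatedP E : ~~ saturated E ->
  exists v a, (exists b u, (v, (b, u)) \in E) /\ (forall u, (v, (a, u)) \notin E).
Proof.
move=> /allPn[a _ /allPn[[v [b u]] vu /hasPn nE]]; exists v, a.
split=> [|u']; first by exists b, u.
by apply/negP => /nE /=; rewrite !eqxx.
Qed.

Section Deterministic.
Variables (E : seq (edge n)).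
Hypotheses (E_det : deterministic E) (E_inv : involutive_edges E).

Lemma reads_det v w u u' : reads E v w u -> reads E v w u' -> u = u'.
Proof.
elim: w v => [|a w IHw] v /=; first by move=> <- <-.
by move=> [t vt tu] [t' vt' tu']; rewrite (E_det vt' vt) in tu'; exact: IHw tu tu'.
Qed.

Lemma reads_winv v w u : reads E v w u -> reads E u (winv w) v.
Proof.
elim: w v => [|a w IHw] v /=; first by move=> ->.
move=> [t vt /IHw ut]; rewrite winv_cons -cats1.
by apply/reads_cat; exists t => //; exists v => //; exact: E_inv.
Qed.

(** Determinism and inverse edges make a backtrack [a a^-1] return to its starting vertex, so
    deleting it keeps both endpoints. *)
Lemma reads_reduce v w u : reads E v w u -> reads E v (reduce_cat w [::]) u.
Proof.
elim: w v => [|a w IHw] v //= [t vt /IHw]; case: (reduce_cat w [::]) => [|b s].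
  by move=> tu; exists t.
rewrite /cons_reduced; case: eqP => [->|_ tu]; last by exists t.
by move=> [t' /(E_det (E_inv vt)) <-].
Qed.

(* Reading [b] permutes a finite set of vertices as long as it never leaves. *)
Lemma reads_cycle v b :
  (exists k, forall u, ~ reads E v (nseq k b) u) \/
  (exists2 k, 0 < k & reads E v (nseq k b) v).
Proof.
have [k_ex|allR] := pselect (exists k, forall u, ~ reads E v (nseq k b) u).
  by left.
right; have R k : exists u, reads E v (nseq k b) u.
  by apply: contrapT => nR; apply: allR; exists k => u Ru; apply: nR; exists u.
pose f k := xget 0 [set u | reads E v (nseq k b) u].
have fP k : reads E v (nseq k b) (f k).
  by have [u Ru] := R k; apply: (@xgetPex _ 0 [set u | reads E v (nseq k b) u]); exists u.
have fE k : f k \in map fst E.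
  have := fP k.+1; rewrite -addn1 nseqD => /reads_cat[u vu [t ut _]].
  by rewrite (reads_det (fP k) vu); exact: (map_f fst ut).
have : ~~ uniq (map f (iota 0 (size E).+1)).
  apply/negP => /uniq_leq_size leE.
  have : size (map f (iota 0 (size E).+1)) <= size (map fst E).
    by apply: leE => _ /mapP[k _ ->].
  by rewrite !size_map size_iota ltnn.
move=> /(uniqPn 0)[i [j [ij]]]; rewrite size_map size_iota => jE.
rewrite !(nth_map 0) ?size_iota ?(ltn_trans ij) // !nth_iota ?(ltn_trans ij) //.
rewrite !add0n => fij; exists (j - i); first by rewrite subn_gt0.
(* Undoing the last [i] letters from the common vertex [f i = f j] leads both to [v] and to the
   vertex reached after [j - i] letters. *)
have := fP j; rewrite -(subnK (ltnW ij)) nseqD => /reads_cat[u vu uj].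
have := reads_winv uj; rewrite (subnK (ltnW ij)) -fij.
by move/(reads_det (reads_winv (fP i))) => vE; rewrite {2}vE.
Qed.

Variable o : nat.
Hypothesis E_conn : connected_from E o.

(** A reduced path [r] from [v] to [p], followed by the missing letter [a], cannot be read. If this
    word begins with [b^-1], a power of a letter [d] of another index is put in front: powers of [d]
    either become unreadable or return to [v]. *)
Lemma escape_from p a v b : 1 < n ->
  (exists b u, (p, (b, u)) \in E) -> (forall u, (p, (a, u)) \notin E) ->
  (exists t, (t, (b, v)) \in E) ->
  exists e, reduced (b :: e) /\ forall u, ~ reads E v e u.
Proof.
move=> n1 [b' [u' pu']] pa [t tv].
have [w1 ov] := E_conn (E_inv tv); have [w2 op] := E_conn pu'.
pose r := reduce_cat (winv w1 ++ w2) [::].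
have rr : reduced r by exact: reduce_catP.
have vp : reads E v r p.
  by apply/reads_reduce/reads_cat; exists o => //; exact: reads_winv.
(* If [r] ended with [a^-1], the inverse of its last edge would leave [p] with label [a]. *)
have r1r : reduced (r ++ [:: a]).
  case/lastP: r rr vp => [//|r z] rr; rewrite -cats1 => /reads_cat[x _ [y xz yp]].
  rewrite yp in xz; rewrite [r ++ [:: z]]cats1 reduced_cat rr andbT; apply/eqP => az.
  by move/negP: (pa x); apply; rewrite az; exact: E_inv.
have r1N u : ~ reads E v (r ++ [:: a]) u.
  move=> /reads_cat[x /(reads_det vp) <- [y py _]].
  by move/negP: (pa y); exact.
case er1: (r ++ [:: a]) r1r r1N => [|y r1] r1r r1N; first by case: (r) er1.
have [yb|yb] := eqVneq y (linv b); last first.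
  by exists (y :: r1); split=> //; rewrite /reduced /= yb.
have [d db] : exists d : letter n, d.1 != b.1.
  pose i0 := Ordinal (ltnW n1); pose i1 : 'I_n := Ordinal n1.
  by have [bi|bi] := eqVneq b.1 i0; [exists (i1, true) | exists (i0, true)];
     rewrite ?bi // eq_sym.
have red_bd k : reduced (b :: nseq k d).
  case: k => // k; rewrite -[b :: _]/([:: b] ++ nseq k.+1 d).
  apply: (@reduced_cat_ends _ d.1 false) => //; first exact: reduced_nseq.
    by rewrite /ends /= eqbF_neg eq_sym.
  by rewrite starts_nseq.
have [[k kN]|[k k0 kv]] := reads_cycle v d; first by exists (nseq k d).
exists (nseq k d ++ y :: r1); split.
  rewrite -cat_cons; apply: (@reduced_cat_ends _ d.1 true) => //.
    by rewrite -cat1s; apply: ends_cat; rewrite ends_nseq ?k0.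
  by rewrite /= yb /= eqbF_neg eq_sym.
by move=> u /reads_cat[x /(reads_det kv) <-]; exact: r1N.
Qed.

(** Vertices are treated one by one: if [c] can still be read from [v], it is extended on the right
    by an escape from the vertex reached. Extensions stay unreadable from earlier vertices, and
    nonemptiness covers the numbers that are no sources. *)
Lemma unreadable_word : 1 < n -> ~~ saturated E ->
  exists2 c, reduced c & forall v u, ~ reads E v c u.
Proof.
move=> n1 /not_saturatedP[p [a [pE pa]]].
suff [c [c0 rc cN]] : exists c, [/\ c <> [::], reduced c &
    forall v u, v \in map fst E -> ~ reads E v c u].
  exists c => // v u; case: c c0 {rc} cN => // b c _ cN /= [t vt tu].
  by apply: (cN v u (map_f fst vt)); exists t.
elim: (map fst E) => [|v s [c [c0 rc cN]]]; first by exists [:: a].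
have [[u cu]|cu] := pselect (exists u, reads E v c u); last first.
  exists c; split=> // v' u; rewrite inE => /orP[/eqP->|/cN//] vu.
  by apply: cu; exists u.
case/lastP: c c0 rc cN cu => [//|c b] _ rc cN cu.
have [t tb] : exists t, (t, (b, u)) \in E.
  by move: cu; rewrite -cats1 => /reads_cat[t _ [y tb <-]]; exists t.
have [e [re eN]] := escape_from n1 pE pa (ex_intro _ t tb : exists t, _).
exists (rcons c b ++ e); split; first by case: (c).
  case: e re {eN} => [|d e]; first by rewrite cats0.
  by rewrite -cat1s => re; rewrite reduced_cat rc /=; move: re; rewrite /reduced /=.
move=> v' x; rewrite inE => /orP[/eqP->|vs] /reads_cat[y vy yx]; last exact: cN vy.
by move: vy => /(reads_det cu) uy; apply: (eN x); rewrite uy.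
Qed.

End Deterministic.
End Graphs.

(** * Folding *)

Section Folding.
Variable n : nat.
Implicit Types (a b : letter n) (w : word n) (E : seq (edge n)).

Definition merge (p : nat * nat) (v : nat) : nat := if v == p.2 then p.1 else v.

Definition merge_edges (p : nat * nat) E : seq (edge n) :=
  [seq (merge p e.1, (e.2.1, merge p e.2.2)) | e <- E].

Definition edge_conflict (q : edge n * edge n) : bool :=
  (q.1.1 == q.2.1) && ((q.1.2.1 == q.2.2.1) && (q.1.2.2 != q.2.2.2)).

Definition edge_pairs E : seq (edge n * edge n) :=
  flatten [seq [seq (e, e') | e' <- E] | e <- E].

Definition conflicts E : seq (nat * nat) :=
  [seq (q.1.2.2, q.2.2.2) | q <- [seq q <- edge_pairs E | edge_conflict q]].

(** Without conflicts the default [(0, 0)] merges [0] with itself, so the step is the identity. *)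
Definition fold_step E : seq (edge n) := merge_edges (head (0, 0) (conflicts E)) E.

(* The second [E] is fuel: every effective step removes a vertex. *)
Definition fold_edges E : seq (edge n) := foldl (fun E' _ => fold_step E') E E.

(* [(size E).+1] is fresh: vertices stay bounded by the number of edges. *)
Definition add_letter (s : nat * seq (edge n)) a : nat * seq (edge n) :=
  ((size s.2).+1,
   (s.1, (a, (size s.2).+1)) :: ((size s.2).+1, (linv a, s.1)) :: s.2).

(** Glues a petal by renaming the end of the new path to the base [0]. Later folding may rename the
    base. *)
Definition add_word E w : seq (edge n) :=
  merge_edges (0, (foldl add_letter (0, E) w).1) (foldl add_letter (0, E) w).2.

Definition stallings (ws : seq (word n)) : seq (edge n) :=
  fold_edges (foldl add_word [::] ws).

Lemma mem_merge_edges p E v a u : (v, (a, u)) \in merge_edges p E ->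
  exists v' u', [/\ (v', (a, u')) \in E, v = merge p v' & u = merge p u'].
Proof. by case/mapP => [[v' [a' u']] vu /= [-> -> ->]]; exists v', u'. Qed.

Lemma merge_edges_in p E v a u : (v, (a, u)) \in E ->
  (merge p v, (a, merge p u)) \in merge_edges p E.
Proof. exact: (map_f (fun e : edge n => (merge p e.1, (e.2.1, merge p e.2.2)))). Qed.

Lemma conflictsP E u u' : (u, u') \in conflicts E <->
  exists v a, [/\ (v, (a, u)) \in E, (v, (a, u')) \in E & u != u'].
Proof.
split=> [/mapP[[e e']]|[v [a [vu vu' uu']]]].
  rewrite mem_filter /edge_conflict /= => /andP[/and3P[/eqP e1 /eqP e2 ne]].
  move=> /allpairsPdep[e0 [e0' [eE eE' [? ?]]]] [? ?]; subst.
  exists e0.1, e0.2.1; rewrite {2}e1 {2}e2 ne; split=> //.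
    by case: (e0) eE => ? [].
  by case: (e0') eE' => ? [].
apply/mapP; exists ((v, (a, u)), (v, (a, u'))) => //.
rewrite mem_filter /edge_conflict /= !eqxx uu' /=.
by apply/allpairsPdep; exists (v, (a, u)), (v, (a, u')).
Qed.

Lemma no_conflict_deterministic E : conflicts E = [::] -> deterministic E.
Proof.
move=> E0 v a u u' vu vu'; apply/eqP; apply/idPn => uu'.
have : (u, u') \in conflicts E by apply/conflictsP; exists v, a.
by rewrite E0.
Qed.

Lemma merge_id E : merge_edges (0, 0) E = E.
Proof.
rewrite /merge_edges -[RHS]map_id; apply: eq_map => [[v [a u]]] /=.
by rewrite /merge /=; do 2!case: eqP => [->|_].
Qed.

(** * Coset labellings, preserved by gluing and folding *)

Section Labelling.
Variable H : set (free_group n).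
Hypothesis sH : is_subgroup H.

(* The vertex [v] stands for the coset [H * tau v]. *)
Record labelling (ws : seq (word n)) E (o : nat) (tau : nat -> free_group n) :
    Prop := Labelling {
  labelling_inv : involutive_edges E;
  labelling_conn : connected_from E o;
  labelling_loop : forall w, w \in ws -> reads E o w o;
  labelling_base : H (tau o);
  labelling_edge : forall v a u, (v, (a, u)) \in E ->
    H (tau v * word_val [:: a] * (tau u)^-1) }.

Lemma coset_sym x y : H (x * y^-1) -> H (y * x^-1).
Proof. by move=> /(subgroupV sH); rewrite invgM invgK. Qed.

Lemma coset_trans x y z : H (x * y^-1) -> H (y * z^-1) -> H (x * z^-1).
Proof. by move=> xy /(subgroupM sH xy); rewrite mulgA mulgVK. Qed.

Lemma coset_merge tau p v : H (tau p.1 * (tau p.2)^-1) ->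
  H (tau (merge p v) * (tau v)^-1).
Proof.
rewrite /merge; case: eqP => [->//|_ _]; rewrite mulgV; exact: subgroup1.
Qed.

Lemma merge_labelling ws E o tau p : labelling ws E o tau ->
  H (tau p.1 * (tau p.2)^-1) -> labelling ws (merge_edges p E) (merge p o) tau.
Proof.
move=> [Ei Ec El Eb Ee] tp; have mP v := coset_merge v tp; split.
- move=> v a u /mem_merge_edges[v' [u' [/Ei vu -> ->]]].
  exact: merge_edges_in.
- move=> v a u /mem_merge_edges[v' [u' [/Ec[w ow] -> _]]].
  by exists w; exact: reads_map.
- by move=> w /El; exact: reads_map.
- by have := subgroupM sH (mP o) Eb; rewrite mulgVK.
- move=> v a u /mem_merge_edges[v' [u' [/Ee vu -> ->]]].
  have := subgroupM sH (subgroupM sH (mP v') vu) (coset_sym (mP u')).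
  by rewrite !mulgA !mulgVK.
Qed.

(** Both targets in a conflict are reached from [v] by the letter [a], so each stands for the coset
    [H * tau v * a]. *)
Lemma fold_step_labelling ws E o tau : labelling ws E o tau ->
  exists o', labelling ws (fold_step E) o' tau.
Proof.
move=> L; exists (merge (head (0, 0) (conflicts E)) o); apply: merge_labelling => //.
case E0: (conflicts E) => [|[u u'] s] /=; first by rewrite mulgV; exact: subgroup1.
have : (u, u') \in conflicts E by rewrite E0 mem_head.
move=> /conflictsP[v [a [/(labelling_edge L) vu /(labelling_edge L) vu' _]]].
exact: coset_trans (coset_sym vu) vu'.
Qed.

Definition vertices E : seq nat := undup (map fst E).

(** The merged vertex [u'] disappears and [u] remains. Inverse edges ensure that both occur among
    the sources counted by [vertices]. *)
Lemma fold_step_vertices E : involutive_edges E -> conflicts E <> [::] ->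
  size (vertices (fold_step E)) < size (vertices E).
Proof.
move=> Ei; rewrite /fold_step; case E0: (conflicts E) => [//|[u u'] s] _ /=.
have : (u, u') \in conflicts E by rewrite E0 mem_head.
move=> /conflictsP[v [a [vu vu' uu']]].
have mem_target x b t : (x, (b, t)) \in E -> t \in vertices E.
  by move=> /Ei xt; rewrite mem_undup; exact: (map_f fst xt).
have /perm_size /= -> := perm_to_rem (mem_target _ _ _ vu').
rewrite ltnS; apply: uniq_leq_size; first exact: undup_uniq.
move=> x; rewrite mem_undup => /mapP[[y [b t]] /mem_merge_edges[y' [t' [yt -> _]]] ->].
rewrite rem_filter ?undup_uniq // mem_filter /merge /=.
case: ifP => [_|->] /=; first by rewrite uu' (mem_target _ _ _ vu).
by rewrite mem_undup; exact: (map_f fst yt).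
Qed.

Lemma fold_edges_deterministic ws E o tau : labelling ws E o tau ->
  deterministic (fold_edges E) /\
  exists o', labelling ws (fold_edges E) o' tau.
Proof.
(* Invariant for the fuel [s]: either no conflict is left and further steps are the identity, or the
   fuel bounds the number of vertices. *)
suff foldP (s : seq (edge n)) : conflicts E = [::] \/ size (vertices E) <= size s ->
    labelling ws E o tau -> deterministic (foldl (fun E' _ => fold_step E') E s) /\
    exists o', labelling ws (foldl (fun E' _ => fold_step E') E s) o' tau.
  by apply: foldP; right; rewrite -(size_map fst E) size_undup.
elim: s E o => [|e s IHs] E o sE L.
  split; last by exists o.
  apply: no_conflict_deterministic; case: sE => // /[!leqn0] /nilP sE0.
  have -> : E = [::]; last by [].
  case: E sE0 {L} => // e E sE0.
  have : e.1 \in vertices (e :: E) by rewrite mem_undup mem_head.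
  by rewrite sE0.
have [o' L'] := fold_step_labelling L; apply: IHs L'.
have [E0|E0] := eqVneq (conflicts E) [::].
  by left; rewrite /fold_step E0 merge_id.
case: sE => [/eqP|sE]; first by rewrite (negbTE E0).
right; rewrite -ltnS (leq_trans _ sE) // fold_step_vertices //; last exact/eqP.
exact: labelling_inv L.
Qed.

Definition bounded_by E : Prop := forall e, e \in E -> e.1 <= size E.

(** The new vertex gets the label [tau v * a]; being larger than all old vertices, it leaves their
    labels untouched. *)
Lemma add_letter_labelling ws s a w tau : bounded_by s.2 -> s.1 <= size s.2 ->
  labelling ws s.2 0 tau -> reads s.2 0 w s.1 -> H (tau s.1 * (word_val w)^-1) ->
  exists tau', [/\ bounded_by (add_letter s a).2,
    (add_letter s a).1 <= size (add_letter s a).2,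
    labelling ws (add_letter s a).2 0 tau',
    reads (add_letter s a).2 0 (rcons w a) (add_letter s a).1 &
    H (tau' (add_letter s a).1 * (word_val (rcons w a))^-1)].
Proof.
case: s => v E /= EB vE L wv tv; set u := (size E).+1.
set E' := [:: _, _ & E]; have sub x : x \in E -> x \in E'.
  by move=> xE; rewrite !inE xE !orbT.
have readsS x t y : reads E x t y -> reads E' x t y.
  by elim: t x => //= b t IHt x [z xz /IHt zy]; exists z => //; exact: sub.
have vE' : (v, (a, u)) \in E' by rewrite mem_head.
have uE' : (u, (linv a, v)) \in E' by rewrite !inE eqxx orbT.
pose tau' x := if x == u then tau v * word_val [:: a] else tau x.
have tau'E x : x <= size E -> tau' x = tau x.
  by move=> xE; rewrite /tau'; case: eqP xE => // ->; rewrite ltnn.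
have wu : reads E' 0 (rcons w a) u.
  by rewrite -cats1; apply/reads_cat; exists v; [exact: readsS | exists u].
have tuE : tau' u = tau v * word_val [:: a] by rewrite /tau' eqxx.
exists tau'; split=> //; last first.
- rewrite tuE -cats1 word_val_cat invgM.
  by rewrite !mulgA mulgK.
- split.
  + move=> x b y; rewrite !inE => /or3P[/eqP[-> -> ->]|/eqP[-> -> ->]|].
    * by rewrite eqxx orbT.
    * by rewrite linvK eqxx.
    * by move=> /(labelling_inv L) ->; rewrite !orbT.
  + move=> x b y; rewrite !inE => /or3P[/eqP[-> _ _]|/eqP[-> _ _]|].
    * by exists w; exact: readsS.
    * by exists (rcons w a).
    * by move=> /(labelling_conn L)[t ot]; exists t; exact: readsS.
  + by move=> t /(labelling_loop L); exact: readsS.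
  + by rewrite tau'E //; exact: labelling_base L.
  + move=> x b y; rewrite !inE => /or3P[/eqP[-> -> ->]|/eqP[-> -> ->]|xy].
    * by rewrite tuE tau'E // mulgV; exact: subgroup1.
    * rewrite tuE tau'E // -(mulgA (tau v)) -word_val_cat.
      rewrite -[_ ++ _]/([:: a] ++ winv [:: a]) word_val_cat word_val_winv.
      by rewrite mulgV mulg1 mulgV; exact: subgroup1.
    * have xE := EB _ xy; have yE := EB _ (labelling_inv L xy).
      by rewrite !tau'E //; exact: (labelling_edge L xy).
- move=> e; rewrite !inE => /or3P[/eqP->|/eqP->|/EB eE] /=.
  + by rewrite (leq_trans vE) // -addn2 leq_addr.
  + by [].
  + by rewrite (leq_trans eE) // -addn2 leq_addr.
Qed.

Lemma add_letters_labelling ws s w' w tau : bounded_by s.2 -> s.1 <= size s.2 ->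
  labelling ws s.2 0 tau -> reads s.2 0 w s.1 -> H (tau s.1 * (word_val w)^-1) ->
  let s' := foldl add_letter s w' in
  exists tau', [/\ bounded_by s'.2, s'.1 <= size s'.2, labelling ws s'.2 0 tau',
    reads s'.2 0 (w ++ w') s'.1 & H (tau' s'.1 * (word_val (w ++ w'))^-1)].
Proof.
elim: w' w s tau => [|a w' IHw] w s tau sB s1 L ws1 t1.
  by exists tau; rewrite cats0.
have [tau' [sB' s1' L' ws1' t1']] := add_letter_labelling a sB s1 L ws1 t1.
by rewrite -cat_rcons; exact: IHw sB' s1' L' ws1' t1'.
Qed.

(** The petal ends at a vertex standing for [H * w], which is [H] because [w] is in [H]; so it may
    be merged with the base. *)
Lemma add_word_labelling ws E w tau : H (word_val w) -> bounded_by E ->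
  labelling ws E 0 tau ->
  exists tau', bounded_by (add_word E w) /\ labelling (w :: ws) (add_word E w) 0 tau'.
Proof.
move=> Hw EB L; have t0 : H (tau 0 * (word_val [::])^-1).
  by rewrite word_val_nil invg1 mulg1; exact: labelling_base L.
have [] := @add_letters_labelling ws (0, E) w [::] tau EB (leq0n _) L erefl t0.
move=> tau' [sB s1 L' ws1 t1]; exists tau'; rewrite /add_word.
set s := foldl _ _ _ in sB s1 L' ws1 t1 *; rewrite cat0s in ws1 t1.
have Lm : labelling ws (merge_edges (0, s.1) s.2) (merge (0, s.1) 0) tau'.
  apply: merge_labelling (L') _; apply: (subgroupM sH (labelling_base L')).
  by apply: (subgroupV sH); have := subgroupM sH t1 Hw; rewrite mulgVK.
have m0 : merge (0, s.1) 0 = 0 by rewrite /merge /=; case: ifP.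
rewrite m0 in Lm; split.
  move=> [v [a u]] /mem_merge_edges[v' [u' [/sB v'E -> _]]].
  by rewrite size_map /merge; case: ifP.
have [Li Lc Ll Lb Le] := Lm; split=> // w'; rewrite inE => /orP[/eqP->|/Ll//].
have := reads_map (merge (0, s.1)) ws1; rewrite m0.
by rewrite {3}/merge eqxx.
Qed.

Lemma stallings_labelling ws : (forall w, w \in ws -> H (word_val w)) ->
  deterministic (stallings ws) /\
  exists o tau, labelling ws (stallings ws) o tau.
Proof.
move=> Hws.
suff [tau L] : exists tau, labelling ws (foldl add_word [::] ws) 0 tau.
  by have [det [o L']] := fold_edges_deterministic L; split=> //; exists o, tau.
(* Each added word is put in front of the list of loops, hence [rev ws]. *)
suff [tau [_ L]] : exists tau, bounded_by (foldl add_word [::] ws) /\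
    labelling (rev ws) (foldl add_word [::] ws) 0 tau.
  exists tau; case: L => Li Lc Ll Lb Le; split=> // w ww.
  by apply: Ll; rewrite mem_rev.
elim/last_ind: ws Hws => [|ws w IHws] Hws.
  exists (fun=> 1); split=> //; split=> //=; exact: subgroup1.
have [|tau [B L]] := IHws; first by move=> v vw; apply: Hws; rewrite mem_rcons inE vw orbT.
rewrite foldl_rcons rev_rcons; apply: (add_word_labelling _ B L).
by apply: Hws; rewrite mem_rcons mem_head.
Qed.

End Labelling.

Lemma reads_label H ws E o tau v w u : is_subgroup H -> labelling H ws E o tau ->
  reads E v w u -> H (tau v * word_val w * (tau u)^-1).
Proof.
move=> sH L; elim: w v => [|a w IHw] v /=.
  by move=> ->; rewrite word_val_nil mulg1 mulgV; exact: subgroup1.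
move=> [t /(labelling_edge L) vt /IHw tu]; have := subgroupM sH vt tu.
by rewrite -[a :: w]cat1s word_val_cat !mulgA mulgVK.
Qed.

(** The elements whose reduced words label loops at [o] form a subgroup that contains the
    generators. *)
Lemma generated_reads ws E o tau x : deterministic E ->
  labelling (generated_by_words ws) ws E o tau -> generated_by_words ws x ->
  reads E o (sval x) o.
Proof.
move=> Ed L /generatedP Hx; apply: (Hx [set y | reads E o (sval y) o]).
  have Ei := labelling_inv L; split=> //= [y z oy oz|y oy].
    rewrite -[reduce_cat _ _](reduce_cats0 (svalP (y * z))).
    have -> : reduce_cat (sval (y * z)) [::] = reduce_cat (sval y ++ sval z) [::].
      by rewrite -!sval_word_val -fg_word_val word_val_cat -!fg_word_val.
    by apply: reads_reduce => //; apply/reads_cat; exists o.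
  exact: reads_winv.
move=> _ [w /= ww <-]; rewrite sval_word_val; apply: reads_reduce => //.
  exact: labelling_inv L.
exact: labelling_loop L _ ww.
Qed.

(** * Index and complements of a subgroup read off its folded graph *)

Variable ws : seq (word n).
Let H := generated_by_words ws.
Hypothesis H_neq1 : H <> [set 1].

Let sH : is_subgroup H.
Proof. exact: generated_subgroup. Qed.

Let Hws w : w \in ws -> H (word_val w).
Proof. by move=> ww; apply: sub_generated; exists w. Qed.

Lemma saturated_finite_index : saturated (stallings ws) -> ~ infinite_index H.
Proof.
move=> sat; have [Ed [o [tau L]]] := stallings_labelling sH Hws.
have Ei := labelling_inv L; have satP := saturatedP sat.
(* A nontrivial element of [H] labels a nonempty loop, which gives the base an edge; saturation says
   nothing about a vertex without edges. *)
have [b [t ob]] : exists b t, (o, (b, t)) \in stallings ws.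
  have [h Hh h1] := subgroup_neq1 sH H_neq1.
  have := generated_reads Ed L Hh; case eh: (sval h) => [|b w] /=.
    by case: h1; apply: val_inj; rewrite /= eh.
  by move=> [t ot _]; exists b, t.
have readsP w : exists2 v, reads (stallings ws) o w v & v \in map fst (stallings ws).
  elim/last_ind: w => [|w a [v ov /mapP[[v' [c u]] vu /= ve]]].
    by exists o => //; exact: (map_f fst ob).
  rewrite -{}ve in vu; have [x vx] := satP _ _ _ a vu.
  exists x; last exact: (map_f fst (Ei _ _ _ vx)).
  by rewrite -cats1; apply/reads_cat; exists v => //; exists x.
apply; apply: (sub_finite_set (B := (fun v => left_coset H (tau v)^-1) @`
  [set` map fst (stallings ws)])); last exact/finite_image/finite_seq.
(* Vertices stand for right cosets and the index counts left cosets, so the inverse of [x] is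
   read. *)
move=> _ [x _ <-]; have [v ov vE] := readsP (sval x^-1); exists v => //.
apply/left_coset_eq => //; rewrite invgK.
have := subgroupM sH (subgroupV sH (labelling_base L)) (reads_label sH L ov).
rewrite -fg_word_val !mulgA mulVg mul1g => /(subgroupV sH).
by rewrite invgM !invgK.
Qed.

Lemma unsaturated_complement : 1 < n -> ~~ saturated (stallings ws) ->
  has_nontrivial_complement H.
Proof.
move=> n1 unsat; have [Ed [o [tau L]]] := stallings_labelling sH Hws.
have Ei := labelling_inv L.
have [c rc cN] := unreadable_word Ed Ei (labelling_conn L) n1 unsat.
apply: (avoided_word_complement n1 sH H_neq1 rc) => x u v Hx xE.
have := generated_reads Ed L Hx; rewrite xE => /reads_cat[s _ /reads_cat[t st _]].
exact: cN st.
Qed.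

Lemma complement_iff_unsaturated : 1 < n ->
  has_nontrivial_complement H <-> ~~ saturated (stallings ws).
Proof.
move=> n1; split; last exact: unsaturated_complement.
move=> /(complement_infinite_index sH) Hinf; apply/negP => sat.
exact: saturated_finite_index sat Hinf.
Qed.

End Folding.

Lemma finitely_generated_words n (H : set (free_group n)) :
  finitely_generated H -> exists ws, H = generated_by_words ws.
Proof.
move=> [A [/finite_seqP[s ->] ->]]; exists (map sval s); congr generated.
apply/seteqP; split=> [x /= xs|_ [w /= /mapP[x xs ->] <-]].
  by exists (sval x); rewrite -?fg_word_val //; exact: map_f.
by rewrite -fg_word_val.
Qed.

(** * Functions computed by programs *)

Local Notation Nil := Defs.Nil.
Local Notation Cons := Defs.Cons.

(** Encodings are found from types; the instances unfold to the encodings by which the decision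
    problem is stated. *)
Class Enc (T : Type) := enc : T -> tree.

#[local] Instance Enc_bool : Enc bool := enc_bool.
#[local] Instance Enc_nat : Enc nat := enc_nat.
#[local] Instance Enc_prod S T {ES : Enc S} {ET : Enc T} : Enc (S * T) :=
  fun x => Cons (enc x.1) (enc x.2).
#[local] Instance Enc_seq T {ET : Enc T} : Enc (seq T) := enc_seq enc.
#[local] Instance Enc_letter n : Enc (letter n) := @enc_letter n.

Definition computable S T {ES : Enc S} {ET : Enc T} (f : S -> T) : Prop :=
  exists p, forall x, eval p (enc x) (enc (f x)).

Section Computable.
Context {A B C : Type} {EA : Enc A} {EB : Enc B} {EC : Enc C}.

Lemma eq_computable (f g : A -> B) : f =1 g -> computable f -> computable g.
Proof. by move=> fg [p pf]; exists p => x; rewrite -fg. Qed.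

Lemma computable_id : computable (fun x : A => x).
Proof. by exists PId => x; constructor. Qed.

Lemma computable_comp (g : B -> C) (f : A -> B) :
  computable g -> computable f -> computable (fun x => g (f x)).
Proof. by move=> [p pg] [q qf]; exists (PSeq q p) => x; apply: ESeq. Qed.

Lemma computable_pair (f : A -> B) (g : A -> C) :
  computable f -> computable g -> computable (fun x => (f x, g x)).
Proof. by move=> [p pf] [q qg]; exists (PCons p q) => x; apply: ECons. Qed.

Lemma computable_fst (f : A -> B * C) :
  computable f -> computable (fun x => (f x).1).
Proof.
move=> [p pf]; exists (PSeq p PHd) => x; apply: ESeq (pf x) _.
exact: (EHd (enc (f x))).
Qed.

Lemma computable_snd (f : A -> B * C) :
  computable f -> computable (fun x => (f x).2).
Proof.
move=> [p pf]; exists (PSeq p PTl) => x; apply: ESeq (pf x) _.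
exact: (ETl (enc (f x))).
Qed.

Lemma computable_cons (f : A -> B) (g : A -> seq B) :
  computable f -> computable g -> computable (fun x => f x :: g x).
Proof. by move=> [p pf] [q qg]; exists (PCons p q) => x; apply: ECons. Qed.

Lemma computable_if (b : A -> bool) (f g : A -> B) :
  computable b -> computable f -> computable g ->
  computable (fun x => if b x then f x else g x).
Proof.
move=> [r rb] [p pf] [q qg]; exists (PIf r p q) => x; have := rb x.
by case: (b x) => ex; [apply: EIfTrue ex _ | apply: EIfFalse ex _].
Qed.

Lemma computable_const (b : B) : computable (fun _ : A => b).
Proof.
have constP t : exists p, forall s, eval p s t.
  elim: t => [|l [p pl] r [q qr]]; first by exists PNil => s; constructor.
  by exists (PCons p q) => s; apply: ECons.
by have [p pP] := constP (enc b); exists p => x.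
Qed.

Lemma computable_nilp (l : A -> seq B) :
  computable l -> computable (fun x => nilp (l x)).
Proof.
move=> [p pl]; exists (PIf p PNil (PCons PNil PNil)) => x; have := pl x.
case: (l x) => [|b s] ls; last by apply: EIfTrue ls _; constructor.
by apply: EIfFalse ls _; apply: ECons; constructor.
Qed.

Lemma computable_behead (l : A -> seq B) :
  computable l -> computable (fun x => behead (l x)).
Proof.
move=> [p pl]; exists (PSeq p PTl) => x; apply: ESeq (pl x) _.
by have := ETl (enc (l x)); case: (l x).
Qed.

Lemma computable_head (b : B) (l : A -> seq B) :
  computable l -> computable (fun x => head b (l x)).
Proof.
move=> [p pl]; have [q qP] := @computable_const b.
exists (PIf p (PSeq p PHd) q) => x; have := pl x.
case: (l x) => [|c s] ls; first by apply: EIfFalse ls _; exact: qP.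
apply: EIfTrue (ls) _; apply: ESeq ls _; exact: (EHd (Cons _ _)).
Qed.

(** The state holds the remaining list, the accumulator and the environment [x]; the loop runs until
    the list is empty. This is the only loop from which the later list functions are built. *)
Lemma computable_foldl (step : A -> B -> C -> B) (init : A -> B)
    (l : A -> seq C) :
  computable (fun y : A * (B * C) => step y.1 y.2.1 y.2.2) ->
  computable init -> computable l ->
  computable (fun x => foldl (step x) (init x) (l x)).
Proof.
move=> [p pP] [q qP] [r rP].
(* Turns [((c :: s, b), x)] into [((s, step x b c), x)]. *)
pose body := PCons (PCons (PSeq (PSeq PHd PHd) PTl)
  (PSeq (PCons PTl (PCons (PSeq PHd PTl) (PSeq (PSeq PHd PHd) PHd))) p)) PTl.
exists (PSeq (PCons (PCons r q) PId)
  (PSeq (PWhile (PSeq PHd PHd) body) (PSeq PHd PTl))) => x.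
apply: (ESeq (t := Cons (Cons (enc (l x)) (enc (init x))) (enc x))).
  by apply: ECons; [apply: ECons | constructor].
elim: (l x) (init x) => [|c s IHs] b.
  apply: (ESeq (t := Cons (Cons Nil (enc b)) (enc x))).
    by apply: EWhileStop; apply: ESeq; constructor.
  by apply: (ESeq (t := Cons Nil (enc b))); [apply: (EHd (Cons _ _)) | apply: ETl].
have := IHs (step x b c) => IH.
(* The induction hypothesis covers the loop together with the extraction of the result; inversion
   separates them so that one iteration can be put in front. *)
inversion IH as [| | | | | ? ? ? t ? ew ef| | | |]; subst.
apply: ESeq ef.
set st := Cons (Cons _ _) _.
have eh : eval PHd st (Cons (Cons (enc c) (enc s)) (enc b)) by apply: (EHd st).
have ehh : eval (PSeq PHd PHd) st (Cons (enc c) (enc s)).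
  by apply: ESeq eh _; apply: (EHd (Cons _ _)).
apply: (EWhileLoop ehh) ew; apply: ECons; last exact: (ETl st).
apply: ECons; first by apply: ESeq ehh _; apply: (ETl (Cons _ _)).
apply: (ESeq (t := enc (x, (b, c)))); last exact: (pP (x, (b, c))).
apply: ECons; first exact: (ETl st).
apply: ECons; first by apply: ESeq eh _; apply: (ETl (Cons _ _)).
by apply: ESeq ehh _; apply: (EHd (Cons _ _)).
Qed.

End Computable.

Ltac computability :=
  cbv beta; try assumption;
  lazymatch goal with
  | |- computable (fun x => x) => exact: computable_id
  | |- computable (fun _ => ?b) => exact: (computable_const b)
  | |- computable fst => exact: (computable_fst computable_id)
  | |- computable snd => exact: (computable_snd computable_id)
  | |- computable (fun x => fst (@?f x)) =>
    apply: (computable_fst (f := f)); computability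
  | |- computable (fun x => snd (@?f x)) =>
    apply: (computable_snd (f := f)); computability
  | |- computable (fun x => pair (@?f x) (@?g x)) =>
    apply: (computable_pair (f := f) (g := g)); computability
  | |- computable (fun x => cons (@?f x) (@?g x)) =>
    apply: (computable_cons (f := f) (g := g)); computability
  | _ => idtac
  end.

Section ComputableSeq.
Context {A B C : Type} {EA : Enc A} {EB : Enc B} {EC : Enc C}.

Lemma computable_rev (l : A -> seq C) :
  computable l -> computable (fun x => rev (l x)).
Proof.
move=> lP; apply: (@eq_computable _ _ _ _
    (fun x => foldl (fun s c => c :: s) [::] (l x))).
  by move=> x; elim/last_ind: (l x) => // s c IHs; rewrite foldl_rcons rev_rcons IHs.
by apply: (computable_foldl (step := fun _ s c => c :: s)); computability.
Qed.

Lemma computable_foldr (step : A -> C -> B -> B) (init : A -> B)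
    (l : A -> seq C) :
  computable (fun y : A * (C * B) => step y.1 y.2.1 y.2.2) ->
  computable init -> computable l ->
  computable (fun x => foldr (step x) (init x) (l x)).
Proof.
move=> stepP initP lP; apply: (@eq_computable _ _ _ _
    (fun x => foldl (fun b c => step x c b) (init x) (rev (l x)))).
  by move=> x; rewrite foldl_rev.
apply: (computable_foldl (step := fun x b c => step x c b)) => //; last first.
  exact: computable_rev.
apply: (computable_comp (g := fun y : A * (C * B) => step y.1 y.2.1 y.2.2)
  (f := fun y : A * (B * C) => (y.1, (y.2.2, y.2.1)))) => //.
by computability.
Qed.

Lemma computable_andb (f g : A -> bool) :
  computable f -> computable g -> computable (fun x => f x && g x).
Proof. by move=> fP gP; apply: computable_if fP gP (computable_const false). Qed.

Lemma computable_negb (f : A -> bool) :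
  computable f -> computable (fun x => ~~ f x).
Proof.
move=> fP; apply: (@eq_computable _ _ _ _ (fun x => if f x then false else true)).
  by move=> x; case: (f x).
by apply: computable_if; computability.
Qed.

End ComputableSeq.

Section ComputableLists.
Context {A B C : Type} {EA : Enc A} {EB : Enc B} {EC : Enc C}.

Lemma computable_map (f : A -> C -> B) (l : A -> seq C) :
  computable (fun y : A * C => f y.1 y.2) -> computable l ->
  computable (fun x => [seq f x c | c <- l x]).
Proof.
move=> fP lP.
apply: (computable_foldr (step := fun x c s => f x c :: s) (init := fun=> [::])) => //.
  apply: computable_cons; last by computability.
  by apply: (computable_comp (f := fun y : A * (C * seq B) => (y.1, y.2.1)) fP);
    computability.
exact: computable_const.
Qed.

Lemma computable_filter (f : A -> pred C) (l : A -> seq C) :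
  computable (fun y : A * C => f y.1 y.2) -> computable l ->
  computable (fun x => [seq c <- l x | f x c]).
Proof.
move=> fP lP.
apply: (computable_foldr (step := fun x c s => if f x c then c :: s else s)
  (init := fun=> [::])) => //; last exact: computable_const.
apply: computable_if; last by computability.
  by apply: (computable_comp (f := fun y : A * (C * seq C) => (y.1, y.2.1)) fP);
    computability.
by computability.
Qed.

Lemma computable_all (f : A -> pred C) (l : A -> seq C) :
  computable (fun y : A * C => f y.1 y.2) -> computable l ->
  computable (fun x => all (f x) (l x)).
Proof.
move=> fP lP.
apply: (computable_foldr (step := fun x c b => f x c && b) (init := fun=> true)) => //;
  last exact: computable_const.
apply: computable_andb; last by computability.
by apply: (computable_comp (f := fun y : A * (C * bool) => (y.1, y.2.1)) fP);
  computability.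
Qed.

Lemma computable_cat (l m : A -> seq C) :
  computable l -> computable m -> computable (fun x => l x ++ m x).
Proof.
move=> lP mP; apply: (@eq_computable _ _ _ _ (fun x => foldr cons (m x) (l x))).
  by move=> x; elim: (l x) => //= c s ->.
by apply: (computable_foldr (step := fun=> cons)) => //; computability.
Qed.

End ComputableLists.

Section ComputableNat.
Context {A C : Type} {EA : Enc A} {EC : Enc C}.

Lemma computable_flatten (l : A -> seq (seq C)) :
  computable l -> computable (fun x => flatten (l x)).
Proof.
move=> lP; apply: (computable_foldr (step := fun=> cat) (init := fun=> [::])) => //.
  by cbv beta; apply: computable_cat; computability.
exact: computable_const.
Qed.

Lemma computable_sizeS (l : A -> seq C) :
  computable l -> computable (fun x => (size (l x)).+1).
Proof.
move=> lP; have succP D (ED : Enc D) (f : D -> nat) : computable f ->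
    computable (fun x => (f x).+1).
  move=> [p pP]; exists (PCons PNil p) => x.
  by apply: (ECons (ENil _)); exact: pP.
apply: (succP); apply: (@eq_computable _ _ _ _ (fun x => foldr (fun=> S) 0 (l x))).
  by move=> x; elim: (l x) => //= c s ->.
apply: (computable_foldr (step := fun x c k => k.+1) (init := fun=> 0)) => //.
  by apply: (succP); computability.
exact: computable_const.
Qed.

(* [enc_nat k] is also the encoding of a list of [k] times [false]. *)
Lemma computable_eqn (f g : A -> nat) :
  computable f -> computable g -> computable (fun x => f x == g x).
Proof.
have nseqP (h : A -> nat) : computable h -> computable (fun x => nseq (h x) false).
  have encE k : enc_nat k = enc_seq enc_bool (nseq k false).
    by elim: k => //= k ->.
  by move=> [p pP]; exists p => x; have := pP x; rewrite [enc (h x)]encE.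
have subP (h k : A -> nat) : computable h -> computable k ->
    computable (fun x => nilp (nseq (h x - k x) false)).
  move=> hP kP; apply: computable_nilp; apply: (@eq_computable _ _ _ _
      (fun x => foldl (fun s _ => behead s) (nseq (h x) false) (nseq (k x) false))).
    move=> x; elim: (k x) (h x) => [|i IHi] j /=; first by rewrite subn0.
    by case: j => [|j]; [rewrite (IHi 0) | rewrite IHi].
  apply: (computable_foldl (step := fun _ s _ => behead s)); [|exact: nseqP..].
  by apply: computable_behead; computability.
(* Two numbers are equal when both truncated differences vanish; a difference is computed by
   dropping list heads. *)
move=> fP gP; apply: (@eq_computable _ _ _ _ (fun x =>
    nilp (nseq (f x - g x) false) && nilp (nseq (g x - f x) false))).
  by move=> x; rewrite /nilp !size_nseq !subn_eq0 eqn_leq.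
by apply: computable_andb; apply: subP.
Qed.

End ComputableNat.

(** * Computability of the operations on labels and vertices *)

Section ComputableFolding.
Variable n : nat.
Context {A : Type} {EA : Enc A}.

(** The index type ['I_n] has no encoding of its own, so the components are extracted by [PHd] and
    [PTl] and the index is compared as a number. *)
Lemma computable_eq_letter (f g : A -> letter n) :
  computable f -> computable g -> computable (fun x => f x == g x).
Proof.
have ordP (h : A -> letter n) : computable h -> computable (fun x => val (h x).1).
  move=> [p pP]; exists (PSeq p PHd) => x; apply: ESeq (pP x) _.
  exact: (EHd (enc (h x))).
have bitP (h : A -> letter n) : computable h -> computable (fun x => (h x).2).
  move=> [p pP]; exists (PSeq p PTl) => x; apply: ESeq (pP x) _.
  exact: (ETl (enc (h x))).
move=> fP gP; apply: (@eq_computable _ _ _ _ (fun x =>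
    (val (f x).1 == val (g x).1) && (if (f x).2 then (g x).2 else ~~ (g x).2))).
  move=> x; case: (f x) (g x) => [i b] [j d]; rewrite xpair_eqE /=.
  by congr (_ && _); case: b d => [] [].
apply: computable_andb; first by apply: computable_eqn; exact: ordP.
apply: computable_if; [|exact: bitP|apply: computable_negb]; exact: bitP.
Qed.

Lemma computable_linv (f : A -> letter n) :
  computable f -> computable (fun x => linv (f x)).
Proof.
move=> [p pP].
exists (PSeq p (PCons PHd (PIf PTl PNil (PCons PNil PNil)))) => x.
apply: ESeq (pP x) _; case: (f x) => i b.
apply: ECons; first exact: (EHd (enc ((i, b) : letter n))).
have : eval PTl (@enc_letter n (i, b)) (enc_bool b) by exact: ETl.
case: b => e.
  by apply: EIfTrue (e) _; constructor.
by apply: EIfFalse (e) _; apply: ECons; constructor.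
Qed.

Lemma computable_merge (p : A -> nat * nat) (v : A -> nat) :
  computable p -> computable v -> computable (fun x => merge (p x) (v x)).
Proof.
move=> pP vP; apply: computable_if => //; last by computability.
by apply: computable_eqn => //; computability.
Qed.

End ComputableFolding.

(** * Computability of the folded graph and of its saturation *)

Section Algorithm.
Variable n : nat.

Lemma computable_merge_edges : 
  computable (fun y : (nat * nat) * seq (edge n) => merge_edges y.1 y.2).
Proof.
apply: (computable_map (f := fun (y : (nat * nat) * seq (edge n)) (e : edge n) =>
  (merge y.1 e.1, (e.2.1, merge y.1 e.2.2)))); last by computability.
by computability; apply: computable_merge; computability.
Qed.

Lemma computable_conflicts : computable (@conflicts n).
Proof.
apply: (computable_map (f := fun _ (q : edge n * edge n) => (q.1.2.2, q.2.2.2))).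
  by computability.
apply: (computable_filter (f := fun=> @edge_conflict n)).
  cbv beta; apply: computable_andb; first by apply: computable_eqn; computability.
  apply: computable_andb; first by apply: computable_eq_letter; computability.
  by apply: computable_negb; apply: computable_eqn; computability.
apply: computable_flatten.
apply: (computable_map (f := fun (E : seq (edge n)) e => [seq (e, e') | e' <- E]));
  last by computability.
by apply: (computable_map (f := fun (y : seq (edge n) * edge n) e' => (y.2, e')));
  computability.
Qed.

Lemma computable_fold_step : computable (@fold_step n).
Proof.
apply: (computable_comp (f := fun E => (head (0, 0) (conflicts E), E))
  computable_merge_edges).
apply: computable_pair; last exact: computable_id.
by apply: computable_head; exact: computable_conflicts.
Qed.

Lemma computable_fold_edges : computable (@fold_edges n).
Proof.
apply: (computable_foldl (step := fun _ E' _ => fold_step E')); [|exact: computable_id..].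
apply: (computable_comp (f := fun y : seq (edge n) * (seq (edge n) * edge n) => y.2.1)
  computable_fold_step).
by computability.
Qed.

Lemma computable_add_word :
  computable (fun y : seq (edge n) * word n => add_word y.1 y.2).
Proof.
have lettersP : computable (fun y : seq (edge n) * word n =>
    foldl (@add_letter n) (0, y.1) y.2).
  apply: (computable_foldl (step := fun=> @add_letter n)); [|by computability..].
  rewrite /add_letter; computability;
    (apply: computable_sizeS || apply: computable_linv); computability.
apply: (computable_comp (f := fun y : seq (edge n) * word n =>
    ((0, (foldl (@add_letter n) (0, y.1) y.2).1), (foldl (@add_letter n) (0, y.1) y.2).2))
  computable_merge_edges).
by computability.
Qed.

Lemma computable_stallings : computable (@stallings n).
Proof.
apply: (computable_comp (f := foldl (@add_word n) [::]) computable_fold_edges).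
apply: (computable_foldl (step := fun=> @add_word n)); [|exact: computable_const|exact: computable_id].
apply: (computable_comp (f := fun y : seq (word n) * (seq (edge n) * word n) => y.2)
  computable_add_word).
by computability.
Qed.

(** The rank is fixed, so the list of all letters is a constant of the program; [has] becomes the
    negation of an [all]. *)
Lemma computable_saturated : computable (@saturated n).
Proof.
apply: (computable_all (f := fun E (a : letter n) =>
  all (fun e : edge n => has (fun e' : edge n => (e'.1 == e.1) && (e'.2.1 == a)) E) E));
  last exact: computable_const.
apply: (computable_all (f := fun (y : seq (edge n) * letter n) (e : edge n) =>
  has (fun e' : edge n => (e'.1 == e.1) && (e'.2.1 == y.2)) y.1));
  last by computability.
apply: (@eq_computable _ _ _ _ (fun y : seq (edge n) * letter n * edge n =>
  ~~ all (fun e' : edge n => ~~ ((e'.1 == y.2.1) && (e'.2.1 == y.1.2))) y.1.1)).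
  by move=> y; rewrite -has_predC; apply: eq_has => e' /=; rewrite negbK.
apply: computable_negb.
apply: (computable_all (f := fun (y : seq (edge n) * letter n * edge n) (e' : edge n) =>
  ~~ ((e'.1 == y.2.1) && (e'.2.1 == y.1.2)))); last by computability.
apply: computable_negb; apply: computable_andb.
  by apply: computable_eqn; computability.
by apply: computable_eq_letter; computability.
Qed.

End Algorithm.

Theorem theorem7p1 (n : nat) (Fn_neq1 : [set: free_group n] <> [set 1]) :
  (forall H : set (free_group n),
     is_subgroup H -> finitely_generated H -> H <> [set 1] ->
     (has_nontrivial_complement H <-> infinite_index H)) /\
  (exists p : prog,
     decides (@enc_words n)
       (fun ws => generated_by_words ws <> [set 1])
       (fun ws => has_nontrivial_complement (generated_by_words ws)) p).
Proof.
have sH ws : is_subgroup (generated_by_words ws : set (free_group n)).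
  exact: generated_subgroup.
have [n1|n1] := leqP n 1.
  split=> [H gH _ H1|].
    split=> [|Hinf]; first exact: complement_infinite_index.
    by case: (rank_le1_finite_index n1 gH H1 Hinf).
  (* In rank at most one no nontrivial subgroup has such a complement, so the constant answer
     [false], encoded as [Nil], is right. *)
  exists PNil => ws H1; exists false; split; first exact: ENil.
  split=> // /(complement_infinite_index (sH ws)) Hinf.
  by case: (rank_le1_finite_index n1 (sH ws) H1 Hinf).
split=> [H _ /finitely_generated_words[ws ->] H1|].
  split=> [|Hinf]; first exact: complement_infinite_index.
  apply: unsaturated_complement => //; apply/negP => sat.
  exact: saturated_finite_index H1 sat Hinf.
have [p pP] : computable (fun ws : seq (word n) => ~~ saturated (stallings ws)).
  apply: computable_negb.
  exact: computable_comp (computable_saturated n) (computable_stallings n).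
exists p => ws H1; exists (~~ saturated (stallings ws)); split; first exact: pP.
by rewrite complement_iff_unsaturated.
Qed.
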